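(* Let $n\ge 1$. There exists exactly one solution $r\in C^2[0,\infty)$ to the initial value problem $$\frac{r''(t)}{1-(r'(t))^2}+\frac{n-1}{t}\,r'(t)=1,\quad t\in(0,\infty),\qquad r(0)=r'(0)=0,$$ and this $r$ is such that $u(x)=r(|x-x_0|)+u(x_0)$ for all $x\in\mathbb{R}^n$, for any radially symmetric $C^2$ solution $u:\mathbb{R}^n\to\mathbb{R}$ of $$\operatorname{div}\left(\frac{\nabla u(x)}{\sqrt{1-|\nabla u(x)|^2}}\right)=\frac{1}{\sqrt{1-|\nabla u(x)|^2}},\qquad |\nabla u(x)|<1,\qquad \forall x\in\mathbb{R}^n,$$ where $x_0$ is the vertex of $u$. Moreover, $r\in C^\infty[0,\infty)$ and $$\frac{t}{\sqrt{n^2+t^2}}\le r'(t)<1,\qquad \forall t\in[0,\infty),$$ $$0<r''(t)\le 1,\qquad \forall t\in[0,\infty).$$ Therefore, all rotationally symmetric spacelike translating solitons of the mean curvature flow $$\frac{\partial V}{\partial t}=\sqrt{1-|\nabla V|^2}\,\operatorname{div}\left(\frac{\nabla V}{\sqrt{1-|\nabla V|^2}}\right)\quad\text{in }\mathbb{R}^n$$ are smooth, strictly convex, unique up to a translation in $\mathbb{R}^{n+1}$, and of linear growth.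
   Context: A translating soliton of the mean curvature flow $\frac{\partial V}{\partial t}=\sqrt{1-|\nabla V|^2}\,\operatorname{div}\left(\frac{\nabla V}{\sqrt{1-|\nabla V|^2}}\right)$ in $\mathbb{R}^n$ is a solution of the form $V(x,t)=u(x)+t$; this means exactly that $u:\mathbb{R}^n\to\mathbb{R}$ satisfies $\operatorname{div}(\nabla u/\sqrt{1-|\nabla u|^2})=1/\sqrt{1-|\nabla u|^2}$ on $\mathbb{R}^n$. It is spacelike if $|\nabla u(x)|<1$ for all $x\in\mathbb{R}^n$. The soliton is identified with the graph of $u$ in $\mathbb{R}^{n+1}$. A function $u$ on $\mathbb{R}^n$ is radially (rotationally) symmetric if there is a point $x_0\in\mathbb{R}^n$, called its vertex, such that $u(x)$ depends only on $|x-x_0|$. Strict convexity of $u$ means that its Hessian is positive definite everywhere; for $u(x)=r(|x-x_0|)+u(x_0)$ with $r\in C^2[0,\infty)$ the solution of the initial value problem $\frac{r''(t)}{1-(r'(t))^2}+\frac{n-1}{t}\,r'(t)=1$ for $t\in(0,\infty)$, $r(0)=r'(0)=0$, this is expressed by $r''>0$ on $[0,\infty)$. Linear growth means that $u(x)$ is bounded above and below, for large $|x|$, by positive constant multiples of $|x|$. *)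

(* Defs.v *)
From HB Require Import structures.
From mathcomp Require Import all_boot all_order all_algebra.
From mathcomp Require Import all_classical all_reals all_analysis.
Set Implicit Arguments.
Unset Strict Implicit.
Unset Printing Implicit Defensive.
Import Order.TTheory GRing.Theory Num.Theory.
Import numFieldNormedType.Exports.
Local Open Scope classical_set_scope.
Local Open Scope ring_scope.

Section HalfLine.
Context {R : realType}.
Implicit Types (f r : R -> R) (t : R).

(** Calculus on [0, +oo[. Only the values of [f] on [0, +oo[ matter: the
    difference quotient at [t] uses increments [h] with [0 <= h + t], so the
    derivative is two-sided for [0 < t] and right-sided at [t = 0]. *)
Definition quotient_filter t : set_system R :=
  within [set h | 0 <= h + t] 0^'.

Definition derivable_nng f t : Prop :=
  cvg ((fun h => h^-1 * (f (h + t) - f t)) @ quotient_filter t).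

Definition derive_nng f t : R :=
  lim ((fun h => h^-1 * (f (h + t) - f t)) @ quotient_filter t).

Definition deriven_nng k f : R -> R := iter k derive_nng f.

Definition Ck_nng k f : Prop :=
  (forall j, (j <= k)%N -> {within `[0, +oo[, continuous (deriven_nng j f)}) /\
  (forall j t, (j < k)%N -> 0 <= t -> derivable_nng (deriven_nng j f) t).

Definition Cinfty_nng f : Prop := forall k, Ck_nng k f.

(** The condition [1 - r'(t)^2 != 0] says that the quotient in the equation is
    defined; division by zero being zero in MathComp, it has to be explicit. *)
Definition radial_ivp_solution (n : nat) r : Prop :=
  [/\ Ck_nng 2 r,
      forall t, 0 < t ->
        1 - derive_nng r t ^+ 2 != 0 /\
        deriven_nng 2 r t / (1 - derive_nng r t ^+ 2)
          + (n%:R - 1) / t * derive_nng r t = 1,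
      r 0 = 0 &
      derive_nng r 0 = 0].

End HalfLine.

Section Euclidean.
Context {R : realType} {n : nat}.
Implicit Types (u f : 'rV[R]_n -> R) (x : 'rV[R]_n) (F : 'rV[R]_n -> 'rV[R]_n).

(** The library norm on ['rV[R]_n] is the sup norm. *)
Definition enorm x : R := Num.sqrt (\sum_i x 0 i ^+ 2).

Definition partial (i : 'I_n) f : 'rV[R]_n -> R := fun x => 'D_(delta_mx 0 i) f x.

Definition partials (s : seq 'I_n) f : 'rV[R]_n -> R := foldr partial f s.

Definition Ck (k : nat) f : Prop :=
  (forall s, (size s <= k)%N -> continuous (partials s f)) /\
  (forall s i x, (size s < k)%N -> derivable (partials s f) x (delta_mx 0 i)).

Definition smooth f : Prop := forall k, Ck k f.

Definition grad u x : 'rV[R]_n := \row_i partial i u x.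

Definition divergence F x : R := \sum_i partial i (fun y => F y 0 i) x.

Definition hessian u x : 'M[R]_n := \matrix_(i, j) partial i (partial j u) x.

Definition posdefmx (A : 'M[R]_n) : Prop :=
  forall v : 'rV[R]_n, v != 0 -> 0 < (v *m A *m v^T) 0 0.

Definition strictly_convex u : Prop := forall x, posdefmx (hessian u x).

Definition area_element u x : R := Num.sqrt (1 - enorm (grad u x) ^+ 2).

Definition mean_curvature u x : R :=
  divergence (fun y => (area_element u y)^-1 *: grad u y) x.

Definition soliton_equation u : Prop :=
  forall x, mean_curvature u x = (area_element u x)^-1.

Definition spacelike u : Prop := forall x, enorm (grad u x) < 1.

Definition mcf_solution (V : 'rV[R]_n -> R -> R) : Prop :=
  [/\ forall t, Ck 2 (V ^~ t),
      forall x t, derivable (V x) t 1 &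
      forall x t, derive1 (V x) t =
        area_element (V ^~ t) x * mean_curvature (V ^~ t) x].

Definition translating_soliton u : Prop := mcf_solution (fun x t => u x + t).

Definition is_vertex u x0 : Prop :=
  forall x y, enorm (x - x0) = enorm (y - x0) -> u x = u y.

Definition radially_symmetric u : Prop := exists x0, is_vertex u x0.

Definition graph u : set 'rV[R]_(n + 1) :=
  [set row_mx x (u x)%:M | x in [set: 'rV[R]_n]].

Definition translate_of u1 u2 : Prop :=
  exists w : 'rV[R]_(n + 1), graph u2 = [set p + w | p in graph u1].

Definition linear_growth u : Prop :=
  exists c C M : R, [/\ 0 < c, 0 < C &
    forall x, M <= enorm x -> c * enorm x <= u x <= C * enorm x].

End Euclidean.

(* Main.v *)
Require Import Defs.
From mathcomp Require Import all_boot all_order all_algebra.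
From mathcomp Require Import all_classical all_reals all_analysis.
From mathcomp Require Import ring lra.
Set Implicit Arguments.
Unset Strict Implicit.
Unset Printing Implicit Defensive.
Import Order.TTheory GRing.Theory Num.Theory.
Import numFieldNormedType.Exports.
Local Open Scope classical_set_scope.
Local Open Scope ring_scope.

(** For a radial function of slope [p = r'], put [m = n - 1] and introduce the
    flux [v = p / sqrt (1 - p^2)]. The soliton equation reads
    [(t^m v)' = t^m sqrt (1 + v^2)], or, integrated from 0,
    [v t = t * avg m (stretch v) t], where [stretch v = sqrt (1 + v^2)] and
    [avg m f t] is the integral of [x^m f (x t)] over [x] in [0, 1]. This
    integral equation makes sense on the whole line and is regular at [t = 0].

    Existence. The Picard iterates from 0 increase with [k] in absolute value,
    are bounded by [exp |t| - 1] and are locally Lipschitz uniformly in [k], so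
    they converge to a continuous fixed point ([flux_fixpoint]). Since
    [(t * avg m f t)' = f t - m * avg m f t] ([is_derive_mul_avg]) and [avg]
    preserves the class C^k ([ck_avg]), the flux is smooth ([flux_smooth]), and
    so are the slope [p = v / stretch v] and its primitive [r = profile m], an
    even function.

    Bounds. From [1 <= stretch v] follows [t / n <= v t], which is the lower
    bound for [p]. As [|v|] increases with [|t|], averaging gives
    [n * avg m (stretch v) <= stretch v], hence
    [v' = stretch v - m * avg m (stretch v) > 0]; then
    [r'' = v' / (stretch v)^3] lies in [(0, 1]].

    Uniqueness. Writing two slopes as hyperbolic tangents of [a_1] and [a_2],
    the equation gives [(a_1 - a_2)' = - (m / t) (tanh a_1 - tanh a_2)], so the
    distance between [a_1] and [a_2] cannot grow from its value 0 at [t = 0]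
    ([slope_unique]).

    Geometry. Restricted to a ray issued from its vertex, a radial soliton has a
    slope satisfying the same equation ([soliton_ode]), so it is
    [r (|x - c|) + u c] by uniqueness ([radial_solitonE]). Because [r] is even,
    [r' t / t] is again smooth and even; partial derivatives of any order thus
    stay in a class of continuous functions ([poly_radial]), which gives
    smoothness at the vertex too. The Hessian takes the values [r' / t] and
    [r''] on unit vectors tangent to and normal to the spheres around the
    vertex, whence strict convexity; the bounds on [r'] give linear growth; and
    two solitons, having the same profile, differ by a translation. *)

(** * Directional derivatives and functions of class C^k on the line *)

Section Derivatives.
Context {R : realType} {V : normedModType R}.
Implicit Types (f g : V -> R) (x v : V).

(** A directional derivative is an ordinary derivative along a line, which
    reduces the chain rule below to its one-variable form. *)
Lemma is_derive_lineP f x v d :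
  is_derive x v f d <-> is_derive (0 : R) 1 (fun h => f (h *: v + x)) d.
Proof.
have E : (fun h : R => h^-1 *: (((fun h => f (h *: v + x)) \o shift 0) (h *: 1)
    - f (0 *: v + x))) = (fun h => h^-1 *: ((f \o shift x) (h *: v) - f x)).
  by apply/funext => h /=; rewrite addr0 scale0r add0r [_%:A]mulr1.
have EN : derivable (fun h : R => f (h *: v + x)) (0 : R) 1 = derivable f x v.
  by rewrite /derivable E.
have ED : 'D_1 (fun h : R => f (h *: v + x)) (0 : R) = 'D_v f x.
  by rewrite /derive E.
by split=> -[df <-]; split; [rewrite EN|exact: ED|rewrite -EN|rewrite -ED].
Qed.

Lemma is_derive_add f g x v a b : is_derive x v f a -> is_derive x v g b ->
  is_derive x v (fun y => f y + g y) (a + b).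
Proof. by move=> fa gb; exact: is_deriveD. Qed.

Lemma is_derive_opp f x v a : is_derive x v f a ->
  is_derive x v (fun y => - f y) (- a).
Proof. by move=> fa; exact: is_deriveN. Qed.

Lemma is_derive_mul f g x v a b : is_derive x v f a -> is_derive x v g b ->
  is_derive x v (fun y => f y * g y) (a * g x + f x * b).
Proof.
move=> fa gb; apply: (is_derive_eq (is_deriveM fa gb)).
by rewrite addrC /GRing.scale /= mulrC.
Qed.

Lemma is_derive_inv f x v a : f x != 0 -> is_derive x v f a ->
  is_derive x v (fun y => (f y)^-1) (- (f x)^-1 ^+ 2 * a).
Proof.
move=> fx0 [df <-]; split; first exact: derivableV.
by rewrite deriveV // exprVn.
Qed.

Lemma is_derive_chain (phi : R -> R) f x v a b :
  is_derive (f x) 1 phi a -> is_derive x v f b ->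
  is_derive x v (fun y => phi (f y)) (a * b).
Proof.
move=> dphi /is_derive_lineP df; apply/is_derive_lineP.
by apply: is_derive1_comp; rewrite scale0r add0r.
Qed.

Lemma is_derive_sqrtr f x v a : 0 < f x -> is_derive x v f a ->
  is_derive x v (fun y => Num.sqrt (f y)) (a / (2 * Num.sqrt (f x))).
Proof.
move=> f0 df; rewrite mulrC.
exact: (@is_derive_chain Num.sqrt _ _ _ _ _ (is_derive1_sqrt f0)).
Qed.

Lemma is_derive_unique f x v a b : is_derive x v f a -> is_derive x v f b ->
  a = b.
Proof. by move=> [_ <-] [_ <-]. Qed.

End Derivatives.

Section Continuity.
Context {R : realType} {T : topologicalType}.
Implicit Types (f g : T -> R).

Lemma cont_add f g : continuous f -> continuous g ->
  continuous (fun x => f x + g x).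
Proof. by move=> cf cg x; apply: cvgD; [exact: cf|exact: cg]. Qed.

Lemma cont_opp f : continuous f -> continuous (fun x => - f x).
Proof. by move=> cf x; apply: cvgN; exact: cf. Qed.

Lemma cont_mul f g : continuous f -> continuous g ->
  continuous (fun x => f x * g x).
Proof. by move=> cf cg x; apply: cvgM; [exact: cf|exact: cg]. Qed.

Lemma cont_sum (I : Type) (r : seq I) (F : I -> T -> R) :
  (forall i, continuous (F i)) -> continuous (fun x => \sum_(i <- r) F i x).
Proof.
move=> cF; elim: r => [|i r IH].
  by under eq_fun do rewrite big_nil; exact: cst_continuous.
by under eq_fun do rewrite big_cons; exact: cont_add.
Qed.

Lemma cont_comp (phi : R -> R) f : continuous phi -> continuous f ->
  continuous (fun x => phi (f x)).
Proof.
move=> cphi cf x; apply: (@continuous_comp _ _ _ f phi); first exact: cf.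
exact: cphi.
Qed.

End Continuity.

Section Line.
Context {R : realType}.
Implicit Types (f g : R -> R) (t : R).

Lemma is_derive_continuous f t a : is_derive t 1 f a -> {for t, continuous f}.
Proof.
by move=> [/derivable1_diffP df _]; exact: differentiable_continuous.
Qed.

Lemma is_derive_idf t : is_derive t 1 (fun x : R => x) 1.
Proof. exact: is_derive_id. Qed.

Lemma is_derive_cstf (c : R) t : is_derive t 1 (fun=> c) 0.
Proof. exact: is_derive_cst. Qed.

Lemma is_derive_dilate f (x t d : R) : is_derive (x * t) 1 f d ->
  is_derive x 1 (fun x => f (x * t)) (d * t).
Proof.
move=> df; have := is_derive_mul (is_derive_idf x) (is_derive_cstf t x).
rewrite mul1r mulr0 addr0 => dl.
exact: (@is_derive_chain _ _ f (fun x : R => x * t) x 1 d t df dl).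
Qed.

Lemma is_derive_reflect f (t d : R) : is_derive (- t) 1 f d ->
  is_derive t 1 (fun s => f (- s)) (- d).
Proof.
move=> df; have := is_derive_chain df (is_derive_opp (is_derive_idf t)).
by rewrite mulrN1.
Qed.

(** A derivative is chosen at each stage; derivatives being unique, this is the
    usual class C^k. Closure under products, inverses and square roots is then
    an induction on [k], since their derivatives are built from the same
    operations applied to functions of class C^k. *)
Fixpoint ck (k : nat) f : Prop :=
  if k is k'.+1 then exists2 f', (forall t, is_derive t 1 f (f' t)) & ck k' f'
  else continuous f.

Definition cinfty f := forall k, ck k f.

Lemma ck_cont k f : ck k f -> continuous f.
Proof.
by case: k => [//|k] [f' df _] t; exact: is_derive_continuous (df t).
Qed.

Lemma ckW k f : ck k.+1 f -> ck k f.
Proof.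
elim: k f => [|k IH] f; first exact: ck_cont.
by move=> [f' df /IH cf']; exists f'.
Qed.

Lemma cinfty_cont f : cinfty f -> continuous f. Proof. by move=> /(_ 0%N). Qed.

Lemma cinfty_derive f f' : cinfty f -> (forall t, is_derive t 1 f (f' t)) ->
  cinfty f'.
Proof.
move=> cf df k; have [g dg cg] := cf k.+1.
suff -> : f' = g by [].
by apply/funext => t; exact: is_derive_unique (df t) (dg t).
Qed.

Lemma cinfty_ex_derive f : cinfty f ->
  exists2 f', (forall t, is_derive t 1 f (f' t)) & cinfty f'.
Proof.
move=> cf; have [f' df _] := cf 1%N; exists f' => //.
exact: cinfty_derive df.
Qed.

Lemma ck_cst k (c : R) : ck k (fun=> c).
Proof.
elim: k c => [|k IH] c; first by move=> ?; exact: cvg_cst.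
by exists (fun=> 0) => // t; exact: is_derive_cst.
Qed.

Lemma ck_id k : ck k (fun t => t).
Proof.
case: k => [|k]; first by move=> t; exact: cvg_id.
exists (fun=> 1); last exact: ck_cst.
by move=> t; exact: is_derive_id.
Qed.

Lemma ck_add k f g : ck k f -> ck k g -> ck k (fun t => f t + g t).
Proof.
elim: k f g => [|k IH] f g; first exact: cont_add.
move=> [f' df cf] [g' dg cg]; exists (fun t => f' t + g' t); last exact: IH.
by move=> t; exact: is_derive_add.
Qed.

Lemma ck_mul k f g : ck k f -> ck k g -> ck k (fun t => f t * g t).
Proof.
elim: k f g => [|k IH] f g; first exact: cont_mul.
move=> /[dup] Cf [f' df cf] /[dup] Cg [g' dg cg].
exists (fun t => f' t * g t + f t * g' t).
  by move=> t; exact: is_derive_mul.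
by apply: ck_add; apply: IH => //; exact: ckW.
Qed.

Lemma ck_opp k f : ck k f -> ck k (fun t => - f t).
Proof.
move=> cf; have := ck_mul (ck_cst k (-1)) cf.
by under eq_fun do rewrite mulN1r.
Qed.

Lemma ck_inv k f : (forall t, f t != 0) -> ck k f -> ck k (fun t => (f t)^-1).
Proof.
move=> f0; elim: k => [|k IH].
  by move=> cf t; apply: cvgV => //; exact: cf.
move=> /[dup] Cf [f' df cf]; exists (fun t => - (f t)^-1 ^+ 2 * f' t).
  by move=> t; exact: is_derive_inv.
apply: ck_mul => //; apply: ck_opp; under eq_fun do rewrite expr2.
by apply: ck_mul; exact/IH/ckW.
Qed.

Lemma ck_sqrt k f : (forall t, 0 < f t) -> ck k f ->
  ck k (fun t => Num.sqrt (f t)).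
Proof.
move=> f0; elim: k => [|k IH].
  exact/cont_comp/sqrt_continuous.
move=> /[dup] Cf [f' df cf].
exists (fun t => f' t / (2 * Num.sqrt (f t))).
  by move=> t; exact: is_derive_sqrtr.
apply: ck_mul => //; apply: ck_inv.
  by move=> t; rewrite mulf_neq0 // gt_eqF // sqrtr_gt0.
by apply: ck_mul; [exact: ck_cst|exact/IH/ckW].
Qed.

Lemma continuous_scaled f (a : R) : continuous f ->
  continuous (fun t => f (a * t)).
Proof.
move=> cf; apply: cont_comp => //; apply: cont_mul; first exact: cst_continuous.
by move=> t; exact: cvg_id.
Qed.

Lemma derive_ge0_nondecreasing f f' a b : a <= b ->
  {within `[a, b], continuous f} ->
  (forall t, a < t < b -> is_derive t 1 f (f' t)) ->
  (forall t, a < t < b -> 0 <= f' t) -> f a <= f b.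
Proof.
rewrite le_eqVlt => /predU1P[->//|ab] cf df f0.
have dfI t : t \in `]a, b[ -> is_derive t 1 f (f' t).
  by rewrite in_itv /= => /df.
have [c] := MVT ab dfI cf.
rewrite in_itv /= => /f0 f'c E.
by rewrite -subr_ge0 E mulr_ge0 // subr_ge0 ltW.
Qed.

End Line.

Lemma is_derive_lin (R : realType) (V : normedModType R) (x v : V) (a b : R)
    (l : V -> R) :
  (forall h, l (h *: v + x) = a * h + b) -> is_derive x v l a.
Proof.
move=> lE; apply/is_derive_lineP; under eq_fun do rewrite lE.
have H := is_derive_add (is_derive_mul (is_derive_cstf a 0) (is_derive_idf 0))
  (is_derive_cstf b 0).
by apply: (is_derive_eq H); rewrite mul0r add0r mulr1 addr0.
Qed.

(** * Weighted averages over dilations *)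

Section Average.
Context {R : realType}.
Implicit Types (f g : R -> R) (t : R) (m : nat).
Local Notation mu := (@lebesgue_measure R).

(** For [t != 0] this is [t^-(m+1)] times the integral of [s^m f s] over [0, t].
    The form over the fixed interval [0, 1] has no singularity at [t = 0]: it is
    there that the equation for the profile degenerates. *)
Definition avg m f t : R := \int[mu]_(x in `[0, 1]) (x ^+ m * f (x * t)).

Lemma continuous_avg_integrand m f t : continuous f ->
  continuous (fun x : R => x ^+ m * f (x * t)).
Proof.
move=> cf; apply: (@ck_mul _ 0); first exact: exprn_continuous.
have := @continuous_scaled _ f t cf.
by under eq_fun do rewrite mulrC.
Qed.

Lemma integrable_avg m f t : continuous f ->
  mu.-integrable `[0, 1] (EFin \o (fun x => x ^+ m * f (x * t))).
Proof.
move=> cf; apply: continuous_compact_integrable; first exact: segment_compact.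
exact/continuous_subspaceT/continuous_avg_integrand.
Qed.

Lemma integrable_cst01 (c : R) : mu.-integrable `[0, 1] (EFin \o (fun=> c)).
Proof.
have := @integrable_avg 0 _ 0 (ck_cst 0 c).
rewrite (_ : (fun x : R => _) = (fun=> c)) //.
by apply/funext => x; rewrite mul1r.
Qed.

Lemma bounded_near f t : continuous f ->
  exists2 M : R, 0 <= M & forall s, `|s| <= `|t| + 1 -> `|f s| <= M.
Proof.
move=> cf.
have cab : {within `[- (`|t| + 1), `|t| + 1], continuous (fun s => `|f s|)}.
  apply: continuous_subspaceT => s.
  apply: (@continuous_comp _ _ _ f (fun y => `|y|)); first exact: cf.
  exact: norm_continuous.
have ab : - (`|t| + 1) <= `|t| + 1 by have := normr_ge0 t; lra.
have [c _ cM] := EVT_max ab cab.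
by exists `|f c| => // s; rewrite ler_norml => ?; apply: cM; rewrite in_itv.
Qed.

Lemma avg_integrand_bound m f t (M : R) : 0 <= M ->
  (forall s, `|s| <= `|t| + 1 -> `|f s| <= M) ->
  forall s x : R, s \in `]t - 1, t + 1[ -> x \in `[0, 1] ->
  `|x ^+ m * f (x * s)| <= M.
Proof.
move=> M0 fM s x; rewrite !in_itv /= => /andP[s1 s2] /andP[x0 x1].
rewrite normrM -[leRHS]mul1r ler_pM //.
  by rewrite ger0_norm ?exprn_ge0 // exprn_ile1.
apply: fM; rewrite normrM -[leRHS]mul1r ler_pM //; first by rewrite ger0_norm.
rewrite ler_norml; have := ler_norm t; have := ler_norm (- t); rewrite normrN.
by move=> *; apply/andP; split; lra.
Qed.

Lemma eq_avg m f g s t : (forall x, 0 <= x <= 1 -> f (x * s) = g (x * t)) ->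
  avg m f s = avg m g t.
Proof.
move=> fg; apply: eq_Rintegral => x; rewrite inE /= in_itv /= => x01.
by rewrite fg.
Qed.

Lemma le_avg m f g s t : continuous f -> continuous g ->
  (forall x, 0 <= x <= 1 -> f (x * s) <= g (x * t)) -> avg m f s <= avg m g t.
Proof.
move=> cf cg fg; apply: le_Rintegral => //; try exact: integrable_avg.
move=> x; rewrite /= in_itv /= => /[dup] x01 /andP[x0 _].
by rewrite ler_wpM2l ?exprn_ge0 // fg.
Qed.

Lemma avg_FTC m f t (G : R -> R) : continuous f ->
  (forall x : R, is_derive x 1 G (x ^+ m * f (x * t))) ->
  avg m f t = G 1 - G 0.
Proof.
move=> cf dG.
have cG : continuous G by move=> x; exact: is_derive_continuous (dG x).
rewrite /avg /Rintegral (@continuous_FTC2 _ _ G) //.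
- exact/continuous_subspaceT/continuous_avg_integrand.
- split.
  + by move=> x _; have [] := dG x.
  + exact/cvg_at_right_filter/cG.
  + exact/cvg_at_left_filter/cG.
- by move=> x _; rewrite derive1E; have [_] := dG x.
Qed.

Lemma is_derive_expr n (x : R) :
  is_derive x 1 (fun x => x ^+ n.+1) (n.+1%:R * x ^+ n).
Proof.
elim: n => [|n IH]; first by rewrite expr0 mulr1; exact: is_derive_id.
under eq_fun do rewrite exprS.
apply: (is_derive_eq (is_derive_mul (is_derive_idf x) IH)).
by rewrite mul1r [in LHS]exprS [in RHS]exprS [in RHS]mulrSr; ring.
Qed.

Lemma avg_cst m (c : R) t : avg m (fun=> c) t = c / m.+1%:R.
Proof.
have dG (x : R) :
    is_derive x 1 (fun x => x ^+ m.+1 * (c / m.+1%:R)) (x ^+ m * c).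
  have := is_derive_mul (is_derive_expr m x) (is_derive_cstf (c / m.+1%:R) x).
  move=> /is_derive_eq; apply.
  have : m.+1%:R != 0 :> R by rewrite pnatr_eq0.
  by move: (m.+1%:R) => a a0; field.
rewrite (avg_FTC (ck_cst 0 c) dG).
by rewrite expr1n expr0n /= mul0r mul1r subr0.
Qed.

Lemma avgZ m f t (c : R) : continuous f ->
  avg m (fun t => c * f t) t = c * avg m f t.
Proof.
move=> cf; rewrite /avg -RintegralZl //; last exact: integrable_avg.
by apply: eq_Rintegral => x _; rewrite mulrCA.
Qed.

Lemma avg_continuous m f : continuous f -> continuous (avg m f).
Proof.
move=> cf t; have [M M0 fM] := bounded_near t cf.
have tI : t \in `]t - 1, t + 1[ by rewrite in_itv /=; apply/andP; split; lra.
apply: (@continuity_under_integral R _ _ mu (fun t x => x ^+ m * f (x * t))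
  `[0, 1] _ (t - 1) (t + 1) _ _ (fun=> M)) => //.
- by move=> s _; exact: integrable_avg.
- apply/aeW => x _ s _.
  exact: (ck_mul (ck_cst 0 (x ^+ m)) (@continuous_scaled R f x cf)).
- exact: integrable_cst01.
- by move=> s sI; apply/aeW => x xI; exact: (avg_integrand_bound _ M0 fM).
- by rewrite inE.
Qed.

Lemma is_derive_avg m f f' t : continuous f' ->
  (forall s : R, is_derive s 1 f (f' s)) ->
  is_derive t 1 (avg m f) (avg m.+1 f' t).
Proof.
move=> cf' df.
have cf : continuous f by move=> s; exact: is_derive_continuous (df s).
have [M M0 fM] := bounded_near t cf'.
have tI : `]t - 1, t + 1[%classic t.
  by rewrite /= in_itv /=; apply/andP; split; lra.
pose F (t x : R) := x ^+ m * f (x * t).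
have dF (s x : R) : is_derive s 1 (F ^~ x) (x ^+ m.+1 * f' (x * s)).
  have dl : is_derive s 1 (fun s => x * s) x.
    have := is_derive_mul (is_derive_cstf x s) (is_derive_idf s).
    by rewrite mul0r add0r mulr1.
  have := is_derive_mul (is_derive_cstf (x ^+ m) s)
    (is_derive_chain (df (x * s)) dl).
  by move=> /is_derive_eq; apply; rewrite exprSr; ring.
have p1F s x : partial1of2 F s x = x ^+ m.+1 * f' (x * s).
  by rewrite partial1of2E; have [] := dF s x.
have h1 : forall x, `]t - 1, t + 1[%classic x ->
    mu.-integrable `[0, 1] (EFin \o F x).
  by move=> x _; exact: integrable_avg.
have h2 : forall x y, `]t - 1, t + 1[%classic x -> `[0, 1]%classic y ->
    derivable (F ^~ y) x 1.
  by move=> x y _ _; have [] := dF x y.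
have h3 := integrable_cst01 M.
have h4 : forall x y, `]t - 1, t + 1[%classic x -> `[0, 1]%classic y ->
    `|partial1of2 F x y| <= M.
  by move=> s x sI xI; rewrite p1F; exact: (avg_integrand_bound _ M0 fM).
have mI : measurable (`[0, 1]%classic : set R) by exact: measurable_itv.
split.
  exact: (@derivable_under_integral R _ _ mu F _ mI t _ _ tI h1 h2
    (fun=> M) (fun=> M0) h3 h4).
rewrite -derive1E (@differentiation_under_integral R _ _ mu F _ mI t _ _ tI
  h1 h2 (fun=> M) (fun=> M0) h3 h4).
by apply: eq_Rintegral => x _; rewrite p1F.
Qed.

Lemma ck_avg k m f : ck k f -> ck k (avg m f).
Proof.
elim: k m f => [|k IH] m f; first exact: avg_continuous.
move=> [f' df cf]; exists (avg m.+1 f'); last exact: IH.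
by move=> t; apply: is_derive_avg => //; exact: ck_cont cf.
Qed.

(** Fundamental theorem of calculus along the segment from 0 to [t]. *)
Lemma avg_deriv f f' t : continuous f' ->
  (forall s : R, is_derive s 1 f (f' s)) -> t * avg 0 f' t = f t - f 0.
Proof.
move=> cf' df.
have [->|t0] := eqVneq t 0; first by rewrite mul0r subrr.
have dG (x : R) :
    is_derive x 1 (fun x => t^-1 * f (x * t)) (x ^+ 0 * f' (x * t)).
  have := is_derive_mul (is_derive_cstf t^-1 x) (is_derive_dilate (df (x * t))).
  by move=> /is_derive_eq; apply; rewrite expr0; field.
by rewrite (avg_FTC cf' dG) mul1r mul0r; field.
Qed.

(* The primitive starts at [-1] so that it is differentiable at 0 as well. *)
Let primitive f : continuous f ->
  exists2 F : R -> R, F 0 = 0 & forall t, -1 < t -> is_derive t 1 F (f t).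
Proof.
move=> cf; pose F0 x := \int[mu]_(t in `[-1, x]) f t.
have dF0 t : -1 < t -> is_derive t 1 F0 (f t).
  move=> t1; have [||||dF EF] := @continuous_FTC1_closed R f (-1) t (t + 1).
  - by rewrite ltrDl.
  - apply: continuous_compact_integrable; first exact: segment_compact.
    exact/continuous_subspaceT.
  - by [].
  - exact: cf.
  by split; [exact: dF|rewrite -derive1E; exact: EF].
exists (fun x => F0 x + - F0 0); first by rewrite subrr.
move=> t /dF0 dt.
by apply: (is_derive_eq (is_derive_add dt (is_derive_cstf _ _))); rewrite addr0.
Qed.

Let is_derive_avg_gt0 m f t : 0 < t -> continuous f ->
  is_derive t 1 (fun t => t * avg m f t) (f t - m%:R * avg m f t).
Proof.
move=> t0 cf.
have [F F0 dF] : exists2 F : R -> R, F 0 = 0 &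
    forall t, -1 < t -> is_derive t 1 F (t ^+ m * f t).
  by apply: primitive; apply: (@ck_mul R 0); first exact: exprn_continuous.
(* [x |-> F (x s) / s^(m+1)] is a primitive of the integrand of [avg m f s]. *)
have avgE s : 0 < s -> avg m f s = F s / s ^+ m.+1.
  move=> s0.
  pose G x := F (x * s) / s ^+ m.+1.
  have dG (x : R) : 0 <= x -> is_derive x 1 G (x ^+ m * f (x * s)).
    move=> x0.
    have xs : -1 < x * s.
      by apply: (lt_le_trans (ltrN10 _)); rewrite mulr_ge0 // ltW.
    have := is_derive_mul (is_derive_dilate (dF _ xs))
      (is_derive_cstf (s ^+ m.+1)^-1 x).
    move=> /is_derive_eq; apply.
    by rewrite mulr0 addr0 exprMn exprS; field; rewrite expf_neq0 ?gt_eqF.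
  have cG : {in `[0, 1], continuous G}.
    by move=> x /itvP xI; apply: is_derive_continuous (dG x _); rewrite xI.
  rewrite /avg /Rintegral (@continuous_FTC2 _ _ G) //=.
  - by rewrite /G mul1r mul0r F0 mul0r subr0.
  - exact/continuous_subspaceT/continuous_avg_integrand.
  - split.
    + by move=> x /itvP xI; have [] := dG x _; rewrite ?xI.
    + by apply/cvg_at_right_filter/cG; rewrite in_itv /= lexx ler01.
    + by apply/cvg_at_left_filter/cG; rewrite in_itv /= lexx ler01.
  - move=> x /itvP xI; rewrite derive1E; have x0 : 0 <= x by rewrite xI.
    by have [_ ->] := dG x x0.
have dH : is_derive t 1 (fun t => F t * (t ^+ m)^-1) (f t - m%:R * avg m f t).
  have t1 : -1 < t by rewrite (lt_trans _ t0) // ltrN10.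
  have tm0 : t ^+ m != 0 by rewrite expf_neq0 ?gt_eqF.
  have dp : is_derive t 1 (fun t => t ^+ m) (m%:R * t ^+ m / t).
    case: m {cf F dF avgE F0 tm0} => [|m].
      by rewrite mul0r mul0r; exact: is_derive_cstf.
    apply: (is_derive_eq (is_derive_expr m t)).
    by rewrite exprS; field; rewrite gt_eqF.
  have := is_derive_mul (dF t t1)
    (@is_derive_inv _ _ (fun t : R => t ^+ m) t 1 _ tm0 dp).
  move=> /is_derive_eq; apply.
  rewrite avgE // [t ^+ m.+1]exprS; move: (t ^+ m) tm0 => z z0.
  by field; rewrite z0 gt_eqF.
apply: near_eq_is_derive dH.
near=> s; have s0 : 0 < s by near: s; exact: lt_nbhsr.
by rewrite avgE // exprS; field; rewrite expf_neq0 ?gt_eqF.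
Unshelve. all: by end_near. Qed.

Lemma avgN m f t : avg m f (- t) = avg m (fun s => f (- s)) t.
Proof. by apply: eq_avg => x _; rewrite mulrN. Qed.

(** The differential equation of the average, [(t A)' = f - m A], that is
    [(t^(m+1) A)' = t^m f]. It holds for [f] merely continuous, and also at
    [t = 0], where both sides equal [A 0 = f 0 / (m + 1)]; [t A] therefore has
    one derivative more than [f]. For [m = 0] it says that [t A] is the
    primitive of [f] vanishing at 0. *)
Lemma is_derive_mul_avg m f t : continuous f ->
  is_derive t 1 (fun t => t * avg m f t) (f t - m%:R * avg m f t).
Proof.
move=> cf; have [t0|t0|->] := ltgtP t 0; last first.
- have ca := avg_continuous (m := m) cf.
  have E : f 0 - m%:R * avg m f 0 = avg m f 0.
    have -> : avg m f 0 = avg m (fun=> f 0) 0.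
      by apply: eq_avg => x _; rewrite mulr0.
    rewrite avg_cst -natr1; field.
    by rewrite natr1 pnatr_eq0.
  rewrite E; apply/is_derive1_caratheodory; exists (avg m f); split => //.
    by move=> z; rewrite mul0r !subr0 mulrC.
  exact: ca.
- exact: is_derive_avg_gt0.
- have cN : continuous (fun s => f (- s)).
    by under eq_fun do rewrite -mulN1r; exact: continuous_scaled.
  have Nt0 : 0 < - t by rewrite oppr_gt0.
  have := is_derive_opp (is_derive_reflect (is_derive_avg_gt0 m Nt0 cN)).
  rewrite (_ : (fun y => _) = (fun t => t * avg m f t)).
    by move=> /is_derive_eq; apply; rewrite -avgN !opprK.
  by apply/funext => s; rewrite -avgN opprK mulNr opprK.
Qed.

Lemma le_avg_0 m f t : continuous f -> (forall s, 0 <= f s) ->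
  avg m f t <= avg 0 f t.
Proof.
move=> cf f0; apply: le_Rintegral => //; try exact: integrable_avg.
move=> x; rewrite /= in_itv /= => /andP[x0 x1].
by rewrite expr0 ler_wpM2r // exprn_ile1.
Qed.

(** Dominated convergence. *)
Lemma cvg_avg m (F : nat -> R -> R) f (M t : R) :
  (forall k, continuous (F k)) -> continuous f ->
  (forall s, F k s @[k --> \oo] --> f s) ->
  (forall k s, `|s| <= `|t| -> `|F k s| <= M) ->
  avg m (F k) t @[k --> \oo] --> avg m f t.
Proof.
move=> cF cf Ff FM.
have fin g : continuous g ->
    (\int[mu]_(x in `[0%R, 1%R]) (x ^+ m * g (x * t))%:E)%E \is a fin_num.
  by move=> cg; apply: integrable_fin_num => //; exact: integrable_avg.
apply: fine_cvg; rewrite fineK; last exact: fin.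
apply: (@dominated_cvg _ _ _ mu _ _
  (fun k x => (x ^+ m * F k (x * t))%:E) _ (EFin \o (fun=> M))) => //=.
- move=> k; have /(measurable_int mu) := @integrable_avg m (F k) t (cF k).
  exact.
- move=> x _; apply: cvg_EFin; first exact: nearW.
  by apply: cvgM; [exact: cvg_cst|exact: Ff].
- exact: integrable_cst01.
- move=> k x; rewrite /= in_itv /= => /andP[x0 x1]; rewrite lee_fin.
  rewrite normrM -[leRHS]mul1r ler_pM //.
    by rewrite ger0_norm ?exprn_ge0 // exprn_ile1.
  by apply: FM; rewrite normrM ger0_norm // ler_piMl.
Qed.

End Average.

(** * The radial profile *)

Section Stretch.
Context {R : realType}.
Implicit Types (v w : R -> R) (t : R).

(** If [v = p / sqrt (1 - p^2)] is the flux belonging to the slope [p], this is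
    [1 / sqrt (1 - p^2)], the right-hand side of the soliton equation. *)
Definition stretch v t : R := Num.sqrt (1 + v t ^+ 2).

Lemma stretch_arg_gt0 v t : 0 < 1 + v t ^+ 2.
Proof. by rewrite ltr_wpDr // sqr_ge0. Qed.

Lemma sqr_stretch v t : stretch v t ^+ 2 = 1 + v t ^+ 2.
Proof. by rewrite sqr_sqrtr // ltW // stretch_arg_gt0. Qed.

Lemma stretch_ge1 v t : 1 <= stretch v t.
Proof. by rewrite -[leLHS]sqrtr1 ler_wsqrtr // lerDl sqr_ge0. Qed.

Lemma stretch_gt0 v t : 0 < stretch v t.
Proof. exact: lt_le_trans ltr01 (stretch_ge1 v t). Qed.

Lemma ck_stretch k v : ck k v -> ck k (stretch v).
Proof.
move=> cv; apply: ck_sqrt; first exact: stretch_arg_gt0.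
apply: ck_add; first exact: ck_cst.
by under eq_fun do rewrite expr2; exact: ck_mul.
Qed.

Lemma le_stretch v w s t : `|v s| <= `|w t| -> stretch v s <= stretch w t.
Proof.
move=> vw; rewrite ler_wsqrtr // lerD2l -[v s ^+ 2]real_normK ?num_real //.
by rewrite -[w t ^+ 2]real_normK ?num_real // ler_pXn2r ?nnegrE.
Qed.

Lemma stretch_le v t (a : R) : `|v t| <= a -> stretch v t <= 1 + a.
Proof.
move=> va; have a0 : 0 <= a by rewrite (le_trans _ va).
rewrite -[leRHS]ger0_norm ?addr_ge0 // -sqrtr_sqr ler_wsqrtr //.
have : v t ^+ 2 <= a ^+ 2.
  by rewrite -[v t ^+ 2]real_normK ?num_real // ler_pXn2r ?nnegrE.
by nra.
Qed.

(** If [|v|] increases with [|t|], so does its stretch, whose average is then at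
    most that of the constant [stretch v t]. This makes the derivative of
    [t * avg m (stretch v) t] positive. *)
Lemma avg_stretch_le (m : nat) v t : continuous v ->
  (forall s t, `|s| <= `|t| -> `|v s| <= `|v t|) ->
  m.+1%:R * avg m (stretch v) t <= stretch v t.
Proof.
move=> cv v_nd; have : avg m (stretch v) t <= avg m (fun=> stretch v t) t.
  apply: le_avg; [exact: (@ck_stretch 0)|exact: (ck_cst 0 (stretch v t))|].
  move=> x /andP[x0 x1]; apply/le_stretch/v_nd.
  by rewrite normrM ger0_norm // ler_piMl.
by rewrite avg_cst ler_pdivlMr ?ltr0n // mulrC.
Qed.

End Stretch.

Section Picard.
Context {R : realType}.
Variable m : nat.
Implicit Types (t : R).

(** Picard iteration for the flux equation [v t = t * avg m (stretch v) t],
    carried out for the quotient [v t / t], which is regular at 0. *)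
Fixpoint flux_quotient_iter (k : nat) : R -> R :=
  if k is k'.+1 then avg m (stretch (fun t => t * flux_quotient_iter k' t))
  else fun=> 0.

Definition flux_iter k t : R := t * flux_quotient_iter k t.

Lemma flux_quotient_iter_cont k : continuous (flux_quotient_iter k).
Proof.
elim: k => [|k IH]; first exact: (ck_cst 0).
apply/avg_continuous/(@ck_stretch _ 0)/(@ck_mul _ 0) => //; exact: (ck_id 0).
Qed.

Lemma flux_iter_cont k : continuous (flux_iter k).
Proof. exact: (@ck_mul _ 0 _ _ (ck_id 0) (@flux_quotient_iter_cont k)). Qed.

Let stretch_cont k : continuous (stretch (flux_iter k)).
Proof. exact/(@ck_stretch _ 0)/flux_iter_cont. Qed.

Lemma flux_quotient_iter_ge0 k t : 0 <= flux_quotient_iter k t.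
Proof.
case: k => [//|k].
have := @le_avg _ m (fun=> 0) _ t t (ck_cst 0 0) (@stretch_cont k).
by rewrite avg_cst mul0r; apply => x _; exact/ltW/stretch_gt0.
Qed.

Lemma norm_flux_iter k t : `|flux_iter k t| = `|t| * flux_quotient_iter k t.
Proof. by rewrite normrM (ger0_norm (flux_quotient_iter_ge0 _ _)). Qed.

Lemma flux_quotient_iter_nondecreasing k s t : `|s| <= `|t| ->
  flux_quotient_iter k s <= flux_quotient_iter k t.
Proof.
elim: k s t => [//|k IH] s t st.
apply: le_avg (@stretch_cont k) (@stretch_cont k) _ => x /andP[x0 x1].
have xst : `|x * s| <= `|x * t| by rewrite !normrM ler_wpM2l.
apply: le_stretch; rewrite !norm_flux_iter.
by rewrite ler_pM ?flux_quotient_iter_ge0 // IH.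
Qed.

Lemma le_norm_flux_iter k s t : `|s| <= `|t| ->
  `|flux_iter k s| <= `|flux_iter k t|.
Proof.
move=> st; rewrite !norm_flux_iter ler_pM ?flux_quotient_iter_ge0 //.
exact: flux_quotient_iter_nondecreasing.
Qed.

Lemma flux_quotient_iterS k t :
  flux_quotient_iter k t <= flux_quotient_iter k.+1 t.
Proof.
elim: k t => [|k IH] t; first exact: flux_quotient_iter_ge0.
apply: le_avg (@stretch_cont k) (@stretch_cont k.+1) _ => x _.
apply: le_stretch; by rewrite !norm_flux_iter ler_wpM2l // IH.
Qed.

(** [exp t - 1] is a supersolution since [sqrt (1 + (e - 1)^2) <= e]. *)
Lemma norm_flux_iter_le k t : `|flux_iter k t| <= expR `|t| - 1.
Proof.
elim: k t => [|k IH] t.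
  by rewrite norm_flux_iter mulr0 subr_ge0 -expR0 ler_expR.
rewrite norm_flux_iter.
have dexp (s : R) : is_derive s 1 expR (expR s) by exact: is_derive_expR.
have cexp : continuous (@expR R) by exact: continuous_expR.
rewrite -[X in _ - X]expR0 -(avg_deriv `|t| cexp dexp) ler_wpM2l //.
have := le_avg_0 m t (@stretch_cont k) (fun s => ltW (stretch_gt0 _ s)).
move=> /le_trans; apply; apply: le_avg => // x /andP[x0 _].
apply: le_trans (stretch_le (IH _)) _.
by rewrite normrM (ger0_norm x0) addrC subrK.
Qed.

Lemma stretch_flux_iter_le k t (M : R) : `|t| <= M ->
  stretch (flux_iter k) t <= expR M.
Proof.
move=> tM; apply: le_trans (stretch_le (norm_flux_iter_le k t)) _.
by rewrite addrC subrK ler_expR.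
Qed.

(** On [-M, M] the iterates increase with slope at most [expR M], uniformly in
    [k]; this is what makes their limit continuous. *)
Lemma flux_iter_lipschitz k (a b M : R) : a <= b -> `|a| <= M -> `|b| <= M ->
  0 <= flux_iter k b - flux_iter k a <= expR M * (b - a).
Proof.
move=> ab; rewrite !ler_norml => /andP[a1 a2] /andP[b1 b2].
case: k => [|k].
  by rewrite /flux_iter !mulr0 subrr lexx mulr_ge0 ?expR_ge0 ?subr_ge0.
set S := stretch (flux_iter k).
have dv t : is_derive t 1 (flux_iter k.+1) (S t - m%:R * avg m S t).
  exact: (is_derive_mul_avg m t (@stretch_cont k)).
have dge0 t : 0 <= S t - m%:R * avg m S t.
  have := avg_stretch_le m t (@flux_iter_cont k) (@le_norm_flux_iter k).
  have := flux_quotient_iter_ge0 k.+1 t; rewrite /= -/S -natr1.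
  by move: (avg m S t) (S t) => A s; lra.
have dleM t : a < t < b -> S t - m%:R * avg m S t <= expR M.
  move=> /andP[at_ tb]; have SM : S t <= expR M.
    by apply: stretch_flux_iter_le; rewrite ler_norml; apply/andP; split; lra.
  apply: le_trans SM; rewrite lerBlDr lerDl mulr_ge0 //.
  exact: (flux_quotient_iter_ge0 k.+1 t).
have cv : {within `[a, b], continuous (flux_iter k.+1)}.
  exact/continuous_subspaceT/flux_iter_cont.
apply/andP; split.
  rewrite subr_ge0.
  exact: (derive_ge0_nondecreasing ab cv (fun t _ => dv t) (fun t _ => dge0 t)).
have dw t : is_derive t 1 (fun t : R => expR M * t + - flux_iter k.+1 t)
    (expR M - (S t - m%:R * avg m S t)).
  have := is_derive_mul (is_derive_cstf (expR M) t) (is_derive_idf t).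
  rewrite mul0r add0r mulr1 => de.
  exact: (is_derive_add de (is_derive_opp (dv t))).
have cw : {within `[a, b],
    continuous (fun t : R => expR M * t + - flux_iter k.+1 t)}.
  by apply: continuous_subspaceT => t; exact: is_derive_continuous (dw t).
have := derive_ge0_nondecreasing ab cw (fun t _ => dw t).
have dw0 t : a < t < b -> 0 <= expR M - (S t - m%:R * avg m S t).
  by move=> /dleM; rewrite subr_ge0.
by move=> /(_ dw0); lra.
Qed.

Lemma flux_iter_cvg t : cvg (flux_iter k t @[k --> \oo]).
Proof.
apply: is_cvgM; first exact: is_cvg_cst.
have [->|t0] := eqVneq t 0.
  apply: (nondecreasing_is_cvgn (u_ := fun k => flux_quotient_iter k 0)).
    by apply/nondecreasing_seqP => k; exact: flux_quotient_iterS.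
  exists (expR 1) => _ [k _ <-].
  apply: le_trans (flux_quotient_iter_nondecreasing k (_ : `|0| <= `|1|)) _.
    by rewrite normr0.
  have := norm_flux_iter_le k 1; rewrite norm_flux_iter normr1 mul1r.
  by move=> /le_trans; apply; rewrite lerBlDr lerDl.
apply: (nondecreasing_is_cvgn (u_ := fun k => flux_quotient_iter k t)).
  by apply/nondecreasing_seqP => k; exact: flux_quotient_iterS.
exists ((expR `|t| - 1) / `|t|) => _ [k _ <-].
rewrite ler_pdivlMr ?normr_gt0 // mulrC -norm_flux_iter.
exact: norm_flux_iter_le.
Qed.

Definition flux t : R := lim (flux_iter k t @[k --> \oo]).

Lemma cvg_flux t : flux_iter k t @[k --> \oo] --> flux t.
Proof. exact: flux_iter_cvg. Qed.

Lemma le_norm_flux s t : `|s| <= `|t| -> `|flux s| <= `|flux t|.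
Proof.
move=> st; have norm_cvg x : `|flux_iter k x| @[k --> \oo] --> `|flux x|.
  by apply: cvg_norm; exact: cvg_flux.
apply: ler_cvg_to (norm_cvg s) (norm_cvg t) _.
by apply: nearW => k; exact: le_norm_flux_iter.
Qed.

Lemma flux_lipschitz (a b M : R) : a <= b -> `|a| <= M -> `|b| <= M ->
  `|flux b - flux a| <= expR M * (b - a).
Proof.
move=> ab aM bM.
have diff_cvg :
    `|flux_iter k b - flux_iter k a| @[k --> \oo] --> `|flux b - flux a|.
  by apply: cvg_norm; apply: cvgB; exact: cvg_flux.
apply: ler_cvg_to diff_cvg (cvg_cst _) _.
apply: nearW => k; have /andP[k0 k1] := flux_iter_lipschitz k ab aM bM.
by rewrite [leLHS]ger0_norm.
Qed.

Lemma flux_cont : continuous flux.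
Proof.
move=> t; apply/cvgrPdist_le => e e0.
set M := `|t| + 1; have M0 : 0 < expR M by exact: expR_gt0.
near=> s.
have st : `|t - s| <= e / expR M.
  by near: s; apply: cvgr_dist_le; [exact: cvg_id|exact: divr_gt0].
have sM : `|s| <= M.
  have : `|t - s| <= 1 by near: s; apply: cvgr_dist_le; [exact: cvg_id|].
  move=> H; rewrite -[s](subrK t) (le_trans (ler_normD _ _)) // /M addrC.
  by rewrite lerD2l distrC.
have tM : `|t| <= M by rewrite lerDl.
have [ts|/ltW st'] := leP t s.
  rewrite distrC; apply: le_trans (flux_lipschitz ts tM sM) _.
  by rewrite mulrC -ler_pdivlMr // (le_trans _ st) // distrC ler_norm.
apply: le_trans (flux_lipschitz st' sM tM) _.
by rewrite mulrC -ler_pdivlMr // (le_trans _ st) // ler_norm.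
Unshelve. all: by end_near. Qed.

Lemma flux_fixpoint t : flux t = t * avg m (stretch flux) t.
Proof.
have H : flux_iter k.+1 t @[k --> \oo] --> t * avg m (stretch flux) t.
  apply: cvgM; first exact: cvg_cst.
  apply: (@cvg_avg _ m (fun k => stretch (flux_iter k)) _ (expR `|t|)) => //.
  - exact/(@ck_stretch _ 0)/flux_cont.
  - move=> s.
    have c2 : 1 + flux_iter k s ^+ 2 @[k --> \oo] --> 1 + flux s ^+ 2.
      by apply: cvgD; [exact: cvg_cst|apply: cvgM; exact: cvg_flux].
    by apply: continuous_cvg c2; exact: sqrt_continuous.
  - move=> k s st; rewrite ger0_norm; last exact/ltW/stretch_gt0.
    exact: stretch_flux_iter_le.
have H' : flux_iter k.+1 t @[k --> \oo] --> flux t.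
  by rewrite (cvg_shiftS (flux_iter ^~ t)); exact: cvg_flux.
exact: cvg_unique H' H.
Qed.

End Picard.

Section Profile.
Context {R : realType}.
Variable m : nat.
Local Notation n := (m.+1).
Implicit Types (t : R).
Local Notation v := (@flux R m).
Local Notation S := (stretch v).

Lemma flux_derive t : is_derive t 1 v (S t - m%:R * avg m S t).
Proof.
have cS : continuous S by exact/(@ck_stretch _ 0)/flux_cont.
have := is_derive_mul_avg m t cS.
by under eq_fun do rewrite -flux_fixpoint.
Qed.

(** Bootstrap: the derivative [stretch v - m * avg m (stretch v)] is of class
    C^k when [v] is. *)
Lemma flux_smooth : cinfty v.
Proof.
elim=> [|k IH]; first exact: flux_cont.
exists (fun t => S t - m%:R * avg m S t); first exact: flux_derive.
have cS := ck_stretch IH.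
by apply/ck_add/ck_opp/ck_mul => //; [exact: ck_cst|exact: ck_avg].
Qed.

Lemma stretch_even t : S (- t) = S t.
Proof. by apply/eqP; rewrite eq_le !le_stretch // le_norm_flux ?normrN. Qed.

Let S_cont : continuous S.
Proof. exact/(@ck_stretch _ 0)/flux_cont. Qed.

Lemma avg_stretch_even t : avg m S (- t) = avg m S t.
Proof. by rewrite avgN; apply: eq_avg => x _; rewrite stretch_even. Qed.

Lemma flux_odd t : v (- t) = - v t.
Proof. by rewrite 2!flux_fixpoint avg_stretch_even mulNr. Qed.

Lemma avg_stretch_ge t : n%:R^-1 <= avg m S t.
Proof.
have := @le_avg _ m (fun=> 1) S t t (ck_cst 0 1) S_cont.
by rewrite avg_cst mul1r; apply => x _; exact: stretch_ge1.
Qed.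

Definition slope t : R := v t / S t.

Definition slope' t : R := (S t - m%:R * avg m S t) / S t ^+ 3.

(** By the differential equation of [avg], this is the primitive of [slope]. *)
Definition profile t : R := t * avg 0 slope t.

Lemma slope_smooth : cinfty slope.
Proof.
move=> k; apply: ck_mul; first exact: flux_smooth.
apply: ck_inv; first by move=> t; rewrite gt_eqF // stretch_gt0.
exact/ck_stretch/flux_smooth.
Qed.

Lemma slope_derive t : is_derive t 1 slope (slope' t).
Proof.
have S0 := stretch_gt0 v t; have S2 := sqr_stretch v t.
have dv := flux_derive t.
set d := S t - _ in dv.
have dS : is_derive t 1 S ((0 + (d * v t + v t * d)) / (2 * S t)).
  apply: (@is_derive_sqrtr _ _ (fun t : R => 1 + v t ^+ 2)).
    exact: stretch_arg_gt0.
  exact: (is_derive_add (is_derive_cstf 1 t) (is_derive_mul dv dv)).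
have SN0 : S t != 0 by rewrite gt_eqF.
have := is_derive_mul dv (is_derive_inv SN0 dS).
move=> /is_derive_eq; apply; rewrite /slope' -/d.
have -> : v t * (- (S t)^-1 ^+ 2 * ((0 + (d * v t + v t * d)) / (2 * S t))) =
    - (d / S t ^+ 3 * v t ^+ 2) by field.
have -> : v t ^+ 2 = S t ^+ 2 - 1 by rewrite S2; ring.
by field.
Qed.

Lemma profile_derive t : is_derive t 1 profile (slope t).
Proof.
have := is_derive_mul_avg 0 t (cinfty_cont slope_smooth).
by rewrite mul0r subr0.
Qed.

Lemma profile_smooth : cinfty profile.
Proof.
by move=> k; apply: ck_mul; [exact: ck_id|exact/ck_avg/slope_smooth].
Qed.

Lemma slope_odd t : slope (- t) = - slope t.
Proof. by rewrite /slope flux_odd stretch_even mulNr. Qed.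

Lemma profile_even t : profile (- t) = profile t.
Proof.
rewrite /profile avgN (_ : avg 0 _ t = - avg 0 slope t) ?mulrNN //.
rewrite -mulN1r -avgZ; last exact: cinfty_cont slope_smooth.
by apply: eq_avg => x _; rewrite slope_odd mulN1r.
Qed.

Lemma profile0 : profile 0 = 0. Proof. exact: mul0r. Qed.

Lemma slope0 : slope 0 = 0.
Proof. by rewrite /slope flux_fixpoint !mul0r. Qed.

Lemma subr_sqr_slope t : 1 - slope t ^+ 2 = (S t ^+ 2)^-1.
Proof.
have S0 : S t != 0 by rewrite gt_eqF // stretch_gt0.
have -> : 1 - slope t ^+ 2 = (S t ^+ 2 - v t ^+ 2) / S t ^+ 2.
  by rewrite /slope; field.
by rewrite sqr_stretch addrK mul1r.
Qed.

Lemma sqr_slope_lt1 t : slope t ^+ 2 < 1.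
Proof.
by rewrite -subr_gt0 subr_sqr_slope invr_gt0 exprn_gt0 // stretch_gt0.
Qed.

Lemma slope_lt1 t : slope t < 1.
Proof.
rewrite (le_lt_trans (ler_norm _)) // -(ltr_pXn2r (n := 2)) ?nnegrE //.
by rewrite expr1n real_normK ?num_real // sqr_slope_lt1.
Qed.

Lemma slope_ode t : 0 < t ->
  slope' t / (1 - slope t ^+ 2) + m%:R / t * slope t = 1.
Proof.
move=> t0; have SN0 : S t != 0 by rewrite gt_eqF // stretch_gt0.
rewrite subr_sqr_slope /slope /slope' [v t]flux_fixpoint.
by field; rewrite SN0 gt_eqF.
Qed.

(** As [p = v / sqrt (1 + v^2)] increases with [v], the bound amounts to
    [t / n <= v t], which holds because [v t = t * avg m S t] and [1 <= S]. *)
Lemma slope_ge t : 0 <= t -> t / Num.sqrt (n%:R ^+ 2 + t ^+ 2) <= slope t.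
Proof.
move=> t0; have n0 : 0 < n%:R :> R by rewrite ltr0n.
have vt : t <= n%:R * v t.
  rewrite flux_fixpoint mulrCA ler_peMr // mulrC -ler_pdivrMr // mul1r.
  exact: avg_stretch_ge.
have v0 : 0 <= v t by rewrite -(pmulr_rge0 _ n0) (le_trans t0).
have D0 : 0 < n%:R ^+ 2 + t ^+ 2 by rewrite ltr_pwDl ?exprn_gt0 ?sqr_ge0.
have S0 := stretch_gt0 v t.
rewrite ler_pdivrMr ?sqrtr_gt0 // mulrAC ler_pdivlMr //.
rewrite -(ler_pXn2r (n := 2)) ?nnegrE ?mulr_ge0 ?sqrtr_ge0 ?(ltW S0) //.
rewrite !exprMn sqr_stretch sqr_sqrtr ?(ltW D0) //.
have : t ^+ 2 <= (n%:R * v t) ^+ 2.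
  by rewrite ler_pXn2r ?nnegrE // mulr_ge0 // ltW.
by rewrite exprMn; nra.
Qed.

Lemma slope'_gt0 t : 0 < slope' t.
Proof.
rewrite divr_gt0 ?exprn_gt0 ?stretch_gt0 //.
have := avg_stretch_le m t (@flux_cont R m) (@le_norm_flux R m).
have := avg_stretch_ge t.
have : 0 < n%:R^-1 :> R by rewrite invr_gt0 ltr0n.
by rewrite -natr1; nra.
Qed.

Lemma slope'_le1 t : slope' t <= 1.
Proof.
have S1 := stretch_ge1 v t; have S0 := stretch_gt0 v t.
rewrite ler_pdivrMr ?exprn_gt0 // mul1r.
have A0 : 0 <= m%:R * avg m S t.
  by rewrite mulr_ge0 // (le_trans _ (avg_stretch_ge t)) // invr_ge0.
have : S t <= S t ^+ 3 by rewrite -[leLHS]expr1 ler_weXn2l.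
by lra.
Qed.

End Profile.

(** * The initial value problem on the half-line *)

Section HalfLine.
Context {R : realType}.
Implicit Types (f g p q : R -> R) (t : R).

Lemma within_itv f t : {within `[0, +oo[, continuous f} ->
  {within `[0, t], continuous f}.
Proof. by apply: continuous_subspaceW; exact: subset_itvl. Qed.

Lemma halfline_primitive_unique f g q :
  {within `[0, +oo[, continuous f} -> {within `[0, +oo[, continuous g} ->
  (forall t, 0 < t -> is_derive t 1 f (q t)) ->
  (forall t, 0 < t -> is_derive t 1 g (q t)) ->
  f 0 = g 0 -> forall t, 0 <= t -> f t = g t.
Proof.
move=> cf cg df dg fg0 t t0.
have cd : {within `[0, t], continuous (fun t => f t + - g t)}.
  by apply: within_itv; apply: cont_add => //; exact: cont_opp.
have dd x : x \in `]0, t[ -> is_derive x 1 (fun t => f t + - g t) (q x + - q x).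
  rewrite in_itv /= => /andP[x0 _].
  exact: (is_derive_add (df x x0) (is_derive_opp (dg x x0))).
have [c _ /eqP] := MVT_segment t0 dd cd.
by rewrite fg0 !subrr subr0 mul0r subr_eq0 => /eqP.
Qed.

(** With [p_i = tanh a_i] the equations become [a_i' = 1 - (m / t) tanh a_i].
    As [tanh] increases, [a_1] and [a_2] can only approach each other, and they
    agree at 0. The function [E] of the proof is [- sinh (a_1 - a_2)^2]
    expressed in terms of [p_1] and [p_2], which avoids the logarithms in
    [a_i]. *)
Lemma slope_unique (m : nat) p1 p2 q1 q2 :
  {within `[0, +oo[, continuous p1} -> {within `[0, +oo[, continuous p2} ->
  (forall t, 0 < t -> is_derive t 1 p1 (q1 t)) ->
  (forall t, 0 < t -> is_derive t 1 p2 (q2 t)) ->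
  (forall t, 0 <= t -> p1 t ^+ 2 < 1) -> (forall t, 0 <= t -> p2 t ^+ 2 < 1) ->
  (forall t, 0 < t -> q1 t / (1 - p1 t ^+ 2) + m%:R / t * p1 t = 1) ->
  (forall t, 0 < t -> q2 t / (1 - p2 t ^+ 2) + m%:R / t * p2 t = 1) ->
  p1 0 = p2 0 -> forall t, 0 <= t -> p1 t = p2 t.
Proof.
move=> c1 c2 d1 d2 b1 b2 o1 o2 p0 t t0.
pose D t := (1 + - (p1 t * p1 t)) * (1 + - (p2 t * p2 t)).
pose E t := - ((p1 t + - p2 t) * (p1 t + - p2 t) * (D t)^-1).
have D0 x : 0 <= x -> 0 < D x.
  by move=> x0; rewrite mulr_gt0 // -expr2 subr_gt0 ?b1 ?b2.
have cE : {within `[0, t], continuous E}.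
  apply: within_itv; apply/cont_opp/cont_mul.
    by apply: cont_mul; apply: cont_add => //; exact: cont_opp.
  have cD : {within `[0, +oo[, continuous D}.
    by apply: cont_mul; (apply: cont_add; [exact: cst_continuous|]);
      apply/cont_opp/cont_mul.
  apply/subspace_continuousP => x x0; apply: cvgV.
    by rewrite gt_eqF // D0 //; move: x0; rewrite /= in_itv /= andbT.
  by move/subspace_continuousP : cD; exact.
pose D' x := (0 + - (q1 x * p1 x + p1 x * q1 x)) * (1 + - (p2 x * p2 x)) +
             (1 + - (p1 x * p1 x)) * (0 + - (q2 x * p2 x + p2 x * q2 x)).
pose E' x := - (((q1 x + - q2 x) * (p1 x + - p2 x) +
               (p1 x + - p2 x) * (q1 x + - q2 x)) * (D x)^-1 +
             (p1 x + - p2 x) * (p1 x + - p2 x) * (- (D x)^-1 ^+ 2 * D' x)).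
have dE x : 0 < x < t -> is_derive x 1 E (E' x).
  move=> /andP[x0 _]; have DN0 : D x != 0 by rewrite gt_eqF // D0 // ltW.
  have d12 := is_derive_add (d1 x x0) (is_derive_opp (d2 x x0)).
  have dsq (p q : R -> R) : is_derive x 1 p (q x) ->
      is_derive x 1 (fun x => 1 + - (p x * p x))
        (0 + - (q x * p x + p x * q x)).
    move=> dp; apply: (is_derive_add (is_derive_cstf 1 x)).
    exact/is_derive_opp/is_derive_mul.
  have dD : is_derive x 1 D (D' x).
    exact: (is_derive_mul (dsq _ _ (d1 x x0)) (dsq _ _ (d2 x x0))).
  exact: (is_derive_opp (is_derive_mul (is_derive_mul d12 d12)
    (is_derive_inv DN0 dD))).
have E'0 x : 0 < x < t -> 0 <= E' x.
  move=> /andP[x0 _]; have x0' := ltW x0.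
  have DN0 : D x != 0 by rewrite gt_eqF // D0.
  have p1x := b1 x x0'; have p2x := b2 x x0'.
  have c1N0 : 1 - p1 x ^+ 2 != 0 by rewrite gt_eqF // subr_gt0.
  have c2N0 : 1 - p2 x ^+ 2 != 0 by rewrite gt_eqF // subr_gt0.
  have qE (p q : R) : 1 - p ^+ 2 != 0 -> q / (1 - p ^+ 2) + m%:R / x * p = 1 ->
      q = (1 - p ^+ 2) * (1 - m%:R / x * p).
    by move=> pN0 /(canRL (addrK _)) o; rewrite mulrC -o divfK.
  have -> : E' x =
      2 * (m%:R / x) * ((p1 x - p2 x) ^+ 2 * (1 - p1 x * p2 x)) / D x.
    rewrite /E' /D' (qE _ _ c1N0 (o1 x x0)) (qE _ _ c2N0 (o2 x x0)).
    by move: DN0; rewrite /D => DN0; field; rewrite c1N0 c2N0 gt_eqF.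
  apply: divr_ge0; last exact/ltW/D0.
  apply: mulr_ge0; first by rewrite mulr_ge0 // divr_ge0.
  by apply: mulr_ge0; [exact: sqr_ge0|nra].
have := derive_ge0_nondecreasing t0 cE dE E'0.
rewrite {1}/E p0 subrr mul0r mul0r oppr0 oppr_ge0 => Et.
have : (p1 t + - p2 t) * (p1 t + - p2 t) <= 0.
  by move: Et; rewrite pmulr_lle0 // invr_gt0 D0.
by rewrite -expr2 => H; apply/eqP; rewrite -subr_eq0 -sqrf_eq0 eq_le H sqr_ge0.
Qed.

Lemma quotient_filter_proper t : 0 <= t -> ProperFilter (quotient_filter t).
Proof.
move=> t0; split; last exact: within_filter.
rewrite /quotient_filter /within /= => /nbhs_ballP[e /= e0 He].
have e20 : 0 < e / 2 by rewrite divr_gt0.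
apply: (He (e / 2)) => /=.
- rewrite /ball /= sub0r normrN gtr0_norm // ltr_pdivrMr // mulr2n mulrDr mulr1.
  by rewrite ltrDl.
- by rewrite gt_eqF.
- by rewrite /= addr_ge0 // ltW.
Qed.

Lemma cvg_quotient f g t d : (forall s, 0 <= s -> f s = g s) ->
  0 <= t -> is_derive t 1 g d ->
  (fun h => h^-1 * (f (h + t) - f t)) @ quotient_filter t --> d.
Proof.
move=> fg t0 [dg gd].
have H : h^-1 * (g (h + t) - g t) @[h --> 0^'] --> d.
  rewrite -gd; move: dg; rewrite /derivable /derive => dg.
  rewrite (_ : (fun h => _) =
    (fun h => h^-1 *: ((g \o shift t) (h *: 1) - g t))) //.
  by apply/funext => h /=; rewrite [h *: 1]mulr1.
have Hw : h^-1 * (g (h + t) - g t) @[h --> quotient_filter t] --> d.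
  by apply: cvg_trans H; apply: cvg_app; exact: cvg_within.
apply: cvg_trans Hw.
apply: near_eq_cvg; rewrite /quotient_filter near_withinE.
by near=> h => /= ht; rewrite !fg.
Unshelve. all: by end_near. Qed.

(** [f] is compared with a function [g] differentiable on both sides of [t]
    because an iterated derivative on the half-line is only controlled at
    nonnegative points. *)
Lemma derivable_nngP f g t d : (forall s, 0 <= s -> f s = g s) ->
  0 <= t -> is_derive t 1 g d -> derivable_nng f t /\ derive_nng f t = d.
Proof.
move=> fg t0 dg; have H := cvg_quotient fg t0 dg.
have PF := quotient_filter_proper t0.
by split; [apply/cvg_ex; exists d|exact/cvg_lim].
Qed.

Lemma deriven_nng_smooth f j : cinfty f ->
  exists2 g, cinfty g & forall t, 0 <= t -> deriven_nng j f t = g t.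
Proof.
move=> cf; elim: j => [|j [g cg gE]]; first by exists f.
have [g' dg cg'] := cinfty_ex_derive cg; exists g' => // t t0.
by have [] := derivable_nngP gE t0 (dg t).
Qed.

Lemma smooth_Cinfty_nng f : cinfty f -> Cinfty_nng f.
Proof.
move=> cf k; split=> [j _|j t _ t0].
  have [g cg gE] := deriven_nng_smooth j cf.
  have : {within `[0, +oo[, continuous g}.
    exact/continuous_subspaceT/cinfty_cont.
  apply: subspace_eq_continuous => x; rewrite inE /= in_itv /= andbT => x0.
  by rewrite /from_subspace gE.
have [g cg gE] := deriven_nng_smooth j cf.
have [g' dg _] := cinfty_ex_derive cg.
by have [] := derivable_nngP gE t0 (dg t).
Qed.

Lemma derivable_nng_is_derive f t : 0 < t -> derivable_nng f t ->
  is_derive t 1 f (derive_nng f t).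
Proof.
move=> t0; rewrite /derivable_nng /derive_nng.
have -> : quotient_filter t = 0^'.
  rewrite /quotient_filter; apply/seteqP; split => A.
    rewrite /within /= => HA.
    have : \forall h \near (0 : R)^', 0 <= h + t.
      apply: cvg_within; near=> h; have : - t < h.
        by near: h; apply: lt_nbhsr; rewrite oppr_lt0.
      by rewrite -subr_gt0 opprK => /ltW.
    by apply: filterS2 HA => h.
  exact: cvg_within.
rewrite (_ : (fun h => _) =
  (fun h => h^-1 *: ((f \o shift t) (h *: 1) - f t))) //.
by apply/funext => h /=; rewrite [h *: 1]mulr1.
Unshelve. all: by end_near. Qed.

Lemma radial_ivp_slope (m : nat) s : radial_ivp_solution m.+1 s ->
  forall t, 0 <= t -> derive_nng s t = slope m t.
Proof.
move=> [[cs ds] ode s0 p0]; set p := derive_nng s in ode p0 *.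
have cp : {within `[0, +oo[, continuous p} by exact: (cs 1%N).
have dp t : 0 < t -> is_derive t 1 p (deriven_nng 2 s t).
  move=> t0; apply: (derivable_nng_is_derive t0).
  by apply: (ds 1%N) => //; exact: ltW.
have p1 t : 0 <= t -> p t ^+ 2 < 1.
  (* By the intermediate value theorem, as [1 - p^2] does not vanish. *)
  move=> t0; rewrite ltNge; apply/negP => pt.
  have cpp : {within `[0, t], continuous (fun t => p t * p t)}.
    by apply: within_itv; exact: cont_mul.
  have [] := @IVT _ (fun t => p t * p t) 0 t 1 t0 cpp.
    by rewrite p0 mul0r -expr2 min_l ?sqr_ge0 // max_r ?sqr_ge0 // ler01.
  move=> c; rewrite in_itv /= => /andP[c0 _] pc.
  have cpos : 0 < c.
    rewrite lt_neqAle c0 andbT; apply/eqP => cE.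
    by move: pc; rewrite -cE p0 mul0r => /esym/eqP; rewrite oner_eq0.
  by have [] := ode c cpos; rewrite expr2 pc subrr eqxx.
have cslope : {within `[0, +oo[, continuous (@slope R m)}.
  exact/continuous_subspaceT/cinfty_cont/slope_smooth.
apply: (@slope_unique m p _ _ _ cp cslope dp (fun t _ => slope_derive m t) p1
  (fun t _ => sqr_slope_lt1 m t)).
- by move=> t /ode[_]; rewrite -natr1 addrK.
- exact: slope_ode.
- by rewrite p0 slope0.
Qed.

Lemma profile_derive_nng (m : nat) t : 0 <= t ->
  derive_nng (profile m) t = slope m t /\
  deriven_nng 2 (profile m) t = slope' m t.
Proof.
move=> t0; have D1 (s : R) : 0 <= s -> derive_nng (profile m) s = slope m s.
  move=> s0.
  by have [] := derivable_nngP (fun s _ => erefl) s0 (profile_derive m s).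
by split; [exact: D1|have [] := derivable_nngP D1 t0 (slope_derive m t)].
Qed.

Lemma profile_radial_ivp (m : nat) : radial_ivp_solution m.+1 (@profile R m).
Proof.
split.
- exact/smooth_Cinfty_nng/profile_smooth.
- move=> t t0; have t0' := ltW t0; have [-> ->] := profile_derive_nng m t0'.
  rewrite -natr1 addrK slope_ode //.
  by rewrite gt_eqF // subr_gt0 sqr_slope_lt1.
- exact: profile0.
- by have [-> _] := profile_derive_nng m (lexx 0); exact: slope0.
Qed.

Lemma radial_ivp_unique (m : nat) s : radial_ivp_solution m.+1 s ->
  forall t, 0 <= t -> s t = profile m t.
Proof.
move=> ivp; have sp := radial_ivp_slope ivp; have [[cs ds] _ s0 _] := ivp.
apply: (@halfline_primitive_unique s (profile m) (slope m)).
- exact: (cs 0%N).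
- exact/continuous_subspaceT/cinfty_cont/profile_smooth.
- move=> t t0; rewrite -sp ?ltW //; apply: (derivable_nng_is_derive t0).
  by apply: (ds 0%N) => //; exact: ltW.
- by move=> t _; exact: profile_derive.
- by rewrite s0 profile0.
Qed.

End HalfLine.

(** * The Euclidean norm and radial functions *)

Section EuclideanNorm.
Context {R : realType} {n : nat}.
Implicit Types (x y c v : 'rV[R]_n) (i j : 'I_n) (t : R).
Local Notation e i := (delta_mx 0 i : 'rV[R]_n).

Lemma sqr_enorm x : enorm x ^+ 2 = \sum_i x 0 i ^+ 2.
Proof. by rewrite sqr_sqrtr // sumr_ge0 // => i _; exact: sqr_ge0. Qed.

Lemma enorm_ge0 x : 0 <= enorm x. Proof. exact: sqrtr_ge0. Qed.

Lemma enormN x : enorm (- x) = enorm x.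
Proof. by congr Num.sqrt; apply: eq_bigr => i _; rewrite mxE sqrrN. Qed.

Lemma enormZ_delta t i : enorm (t *: e i) = `|t|.
Proof.
rewrite -sqrtr_sqr; congr Num.sqrt; rewrite (bigD1 i) //= big1 => [|j ji].
  by rewrite !mxE !eqxx mulr1 addr0.
by rewrite !mxE eqxx (negPf ji) mulr0 expr0n.
Qed.

Lemma enorm_gt0 x : (0 < enorm x) = (x != 0).
Proof.
rewrite sqrtr_gt0 lt_neqAle sumr_ge0 ?andbT => [|i _]; last exact: sqr_ge0.
congr (~~ _); apply/eqP/eqP => [|->]; last first.
  by rewrite big1 // => i _; rewrite mxE expr0n.
move=> /esym/eqP; rewrite psumr_eq0 => [/allP H|i _]; last exact: sqr_ge0.
apply/rowP => i; rewrite mxE; apply/eqP.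
by rewrite -sqrf_eq0; exact: (implyP (H i (mem_index_enum i))).
Qed.

Lemma cauchy_schwarz_row x y :
  (\sum_i x 0 i * y 0 i) ^+ 2 <= enorm x ^+ 2 * enorm y ^+ 2.
Proof.
have [->|x0] := eqVneq x 0.
  rewrite big1 => [|i _]; last by rewrite mxE mul0r.
  by rewrite expr0n /= mulr_ge0 ?sqr_ge0.
have a0 : 0 < enorm x ^+ 2 by rewrite exprn_gt0 // enorm_gt0.
have expand (a b : R) : \sum_i (a * y 0 i - b * x 0 i) ^+ 2 =
    a ^+ 2 * (\sum_i y 0 i ^+ 2) - 2 * a * b * (\sum_i x 0 i * y 0 i)
    + b ^+ 2 * (\sum_i x 0 i ^+ 2).
  by rewrite !mulr_sumr -sumrN -!big_split /=; apply: eq_bigr => i _; ring.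
have : 0 <= \sum_i (enorm x ^+ 2 * y 0 i - (\sum_i x 0 i * y 0 i) * x 0 i) ^+ 2.
  by apply: sumr_ge0 => i _; exact: sqr_ge0.
rewrite expand -!sqr_enorm; set b := \sum_i _; set a := enorm x ^+ 2 in a0 *.
have -> : a ^+ 2 * enorm y ^+ 2 - 2 * a * b * b + b ^+ 2 * a =
  a * (a * enorm y ^+ 2 - b ^+ 2) by ring.
by rewrite pmulr_rge0 // subr_ge0.
Qed.

Lemma ler_enormD x y : enorm (x + y) <= enorm x + enorm y.
Proof.
have x0 := enorm_ge0 x; have y0 := enorm_ge0 y.
rewrite -(ler_pXn2r (n := 2)) ?nnegrE ?addr_ge0 ?enorm_ge0 //.
have -> : enorm (x + y) ^+ 2 =
    enorm x ^+ 2 + 2 * (\sum_i x 0 i * y 0 i) + enorm y ^+ 2.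
  rewrite !sqr_enorm mulr_sumr -!big_split /=; apply: eq_bigr => i _.
  by rewrite mxE; ring.
have : \sum_i x 0 i * y 0 i <= enorm x * enorm y.
  rewrite (le_trans (ler_norm _)) // -(ler_pXn2r (n := 2)) ?nnegrE ?mulr_ge0 //.
  by rewrite real_normK ?num_real // exprMn cauchy_schwarz_row.
by move: (\sum_i _) => b; nra.
Qed.

Lemma is_derive_coord x c i j :
  is_derive x (e i) (fun y => (y - c) 0 j) (j == i)%:R.
Proof.
apply: (is_derive_lin (b := (x - c) 0 j)) => h.
by rewrite !mxE eqxx /= [_ * h]mulrC addrA.
Qed.

Lemma is_derive_sqr_enorm x c i :
  is_derive x (e i) (fun y => \sum_j (y - c) 0 j ^+ 2) (2 * (x - c) 0 i).
Proof.
have H j : is_derive x (e i) (fun y => (y - c) 0 j * (y - c) 0 j)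
    ((j == i)%:R * (x - c) 0 j + (x - c) 0 j * (j == i)%:R).
  by apply: is_derive_mul; exact: is_derive_coord.
have := is_derive_sum H.
rewrite (_ : \sum_(j < n) _ = (fun y => \sum_j (y - c) 0 j ^+ 2)); last first.
  by apply/funext => y; rewrite fct_sumE; apply: eq_bigr => j _; rewrite expr2.
move=> /is_derive_eq; apply; rewrite (bigD1 i) //= big1 => [|j ji].
  by rewrite eqxx mul1r mulr1 addr0; ring.
by rewrite (negPf ji) mul0r mulr0 addr0.
Qed.

Lemma is_derive_enorm x c i : x != c ->
  is_derive x (e i) (fun y => enorm (y - c)) ((x - c) 0 i / enorm (x - c)).
Proof.
move=> xc; have N0 : 0 < enorm (x - c) by rewrite enorm_gt0 subr_eq0.
have S0 : 0 < \sum_j (x - c) 0 j ^+ 2 by rewrite -sqr_enorm exprn_gt0.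
have := @is_derive_sqrtr _ _ (fun y => \sum_j (y - c) 0 j ^+ 2) _ _ _ S0
  (is_derive_sqr_enorm x c i).
move=> /is_derive_eq; apply; rewrite -/(enorm _).
by field; rewrite gt_eqF.
Qed.

Lemma cont_coord c j : continuous (fun y : 'rV[R]_n => (y - c) 0 j).
Proof.
under eq_fun do rewrite !mxE.
apply: cont_add; first exact: coord_continuous.
exact: cst_continuous.
Qed.

Lemma cont_enorm c : continuous (fun y : 'rV[R]_n => enorm (y - c)).
Proof.
apply: (@cont_comp _ _ Num.sqrt); first exact: sqrt_continuous.
apply: cont_sum => j.
exact: (cont_mul (@cont_coord c j) (@cont_coord c j)).
Qed.

(** Away from the center this is the chain rule. At the center, where the norm
    is not differentiable, evenness makes the restriction to a line equal to
    [f `|h| = f h], with derivative [0 * q 0]. *)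
Lemma is_derive_radial (f q : R -> R) c x i :
  (forall t, f (- t) = f t) -> (forall t : R, is_derive t 1 f (t * q t)) ->
  is_derive x (e i) (fun y => f (enorm (y - c)))
    ((x - c) 0 i * q (enorm (x - c))).
Proof.
move=> fN df; have [->|xc] := eqVneq x c.
  apply/is_derive_lineP; rewrite subrr mxE mul0r.
  rewrite (_ : (fun h : R => _) = f).
    by apply: (is_derive_eq (df 0)); rewrite mul0r.
  apply/funext => h; rewrite addrK enormZ_delta.
  by case: ger0P => _; rewrite ?fN.
have N0 : enorm (x - c) != 0 by rewrite gt_eqF // enorm_gt0 subr_eq0.
have := @is_derive_chain _ _ f (fun y => enorm (y - c)) _ _ _ _
  (df (enorm (x - c))) (is_derive_enorm i xc).
by move=> /is_derive_eq; apply; field.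
Qed.

End EuclideanNorm.

Section Even.
Context {R : realType}.

Lemma even_derive (f f' : R -> R) : (forall t, f (- t) = f t) ->
  (forall t : R, is_derive t 1 f (f' t)) -> forall t, f' (- t) = - f' t.
Proof.
move=> fN df t; have := is_derive_reflect (df (- t)).
rewrite (_ : (fun s : R => _) = f); last by apply/funext => s; rewrite fN.
by move=> d; rewrite (is_derive_unique (df t) d) opprK.
Qed.

Lemma odd_derive (f f' : R -> R) : (forall t, f (- t) = - f t) ->
  (forall t : R, is_derive t 1 f (f' t)) -> forall t, f' (- t) = f' t.
Proof.
move=> fN df t; have := is_derive_opp (is_derive_reflect (df (- t))).
rewrite (_ : (fun s : R => _) = f); last by apply/funext => s; rewrite fN opprK.
by rewrite opprK => d; rewrite (is_derive_unique (df t) d).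
Qed.

(** [g t / t] is the average of [g'] over [0, t], hence smooth at 0. *)
Lemma odd_quotient (g : R -> R) : cinfty g -> (forall t, g (- t) = - g t) ->
  exists q, [/\ cinfty q, forall t, q (- t) = q t & forall t, g t = t * q t].
Proof.
move=> cg gN; have [g' dg cg'] := cinfty_ex_derive cg.
exists (avg 0 g'); split.
- by move=> k; exact: ck_avg.
- move=> t; rewrite avgN; apply: eq_avg => x _.
  exact: odd_derive gN dg _.
- move=> t; rewrite (avg_deriv t (cinfty_cont cg') dg).
  have : g 0 = 0 by have := gN 0; rewrite oppr0; lra.
  by move=> ->; rewrite subr0.
Qed.

Lemma even_derive_quotient (f : R -> R) : cinfty f ->
  (forall t, f (- t) = f t) ->
  exists q, [/\ cinfty q, forall t, q (- t) = q t &
    forall t : R, is_derive t 1 f (t * q t)].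
Proof.
move=> cf fN; have [f' df cf'] := cinfty_ex_derive cf.
have [q [cq qN qE]] := odd_quotient cf' (even_derive fN df).
by exists q; split=> // t; rewrite -qE.
Qed.

End Even.

Section PolyRadial.
Context {R : realType} {n : nat}.
Variable c : 'rV[R]_n.
Implicit Types (f g : 'rV[R]_n -> R).

(** A class containing the smooth radial functions and closed under partial
    derivatives, so that continuity of its members gives smoothness. *)
Inductive poly_radial : ('rV[R]_n -> R) -> Prop :=
| PolyRadial_radial (phi : R -> R) : cinfty phi ->
    (forall t, phi (- t) = phi t) -> poly_radial (fun x => phi (enorm (x - c)))
| PolyRadial_coord i : poly_radial (fun x => (x - c) 0 i)
| PolyRadial_add f g : poly_radial f -> poly_radial g ->
    poly_radial (fun x => f x + g x)
| PolyRadial_mul f g : poly_radial f -> poly_radial g ->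
    poly_radial (fun x => f x * g x).

Lemma poly_radial_cst (a : R) : poly_radial (fun=> a).
Proof. by apply: (@PolyRadial_radial (fun=> a)) => // k; exact: ck_cst. Qed.

Lemma poly_radial_cont f : poly_radial f -> continuous f.
Proof.
elim=> [phi cphi _|i|{}f g _ cf _ cg|{}f g _ cf _ cg].
- by apply: cont_comp; [exact: cinfty_cont|exact: cont_enorm].
- exact: cont_coord.
- exact: cont_add.
- exact: cont_mul.
Qed.

Lemma poly_radial_derive f i : poly_radial f ->
  exists2 f', poly_radial f' & forall x, is_derive x (delta_mx 0 i) f (f' x).
Proof.
elim=> [phi cphi phiN|j|{}f g pf [f' pf' df] pg [g' pg' dg]
  |{}f g pf [f' pf' df] pg [g' pg' dg]].
- have [q [cq qN dphi]] := even_derive_quotient cphi phiN.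
  exists (fun x => (x - c) 0 i * q (enorm (x - c))).
    apply: PolyRadial_mul; first exact: PolyRadial_coord.
    exact: PolyRadial_radial.
  by move=> x; exact: is_derive_radial.
- exists (fun=> (j == i)%:R); first exact: poly_radial_cst.
  by move=> x; exact: is_derive_coord.
- exists (fun x => f' x + g' x); first exact: PolyRadial_add.
  by move=> x; exact: is_derive_add.
- exists (fun x => f' x * g x + f x * g' x).
    by apply: PolyRadial_add; exact: PolyRadial_mul.
  by move=> x; exact: is_derive_mul.
Qed.

Lemma poly_radial_partials f s : poly_radial f -> poly_radial (partials s f).
Proof.
move=> pf; elim: s => [//|i s IH] /=.
have [f' pf' df] := poly_radial_derive i IH.
rewrite (_ : partial i _ = f') //; apply/funext => x.
by have [_] := df x.
Qed.

Lemma poly_radial_smooth f : poly_radial f -> smooth f.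
Proof.
move=> pf k; split=> [s _|s i x _].
  exact/poly_radial_cont/poly_radial_partials.
by have [f' _ /(_ x)[]] := poly_radial_derive i (poly_radial_partials s pf).
Qed.

End PolyRadial.

(** * Radial solitons satisfy the initial value problem *)

Section RadialSoliton.
Context {R : realType} {m : nat}.
Local Notation n := m.+1.
Variables (u : 'rV[R]_n -> R) (c : 'rV[R]_n).
Hypotheses (u2 : Ck 2 u) (uc : is_vertex u c).
Local Notation e i := (delta_mx 0 i : 'rV[R]_n).
Implicit Types (t : R) (x y : 'rV[R]_n) (i : 'I_n).

Definition ray t : 'rV[R]_n := t *: e 0 + c.

(* Height and slope of [u] along the ray; by symmetry they determine [u]. *)
Let U t : R := u (ray t).
Let p t : R := partial 0 u (ray t).
Let q t : R := partial 0 (partial 0 u) (ray t).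

Lemma is_derive_ray (f : 'rV[R]_n -> R) t d : is_derive (ray t) (e 0) f d ->
  is_derive t 1 (fun s => f (ray s)) d.
Proof.
have E : (fun h : R => h^-1 *: (((fun s => f (ray s)) \o shift t) (h *: 1)
      - f (ray t))) =
    (fun h => h^-1 *: ((f \o shift (ray t)) (h *: e 0) - f (ray t))).
  apply/funext => h /=; congr (_ *: (f _ - _)).
  by rewrite /ray [h *: 1]mulr1 scalerDl addrA.
by move=> [df <-]; split; rewrite /derivable /derive E.
Qed.

Lemma enorm_ray t : enorm (ray t - c) = `|t|.
Proof. by rewrite addrK enormZ_delta. Qed.

Lemma radialE y : u y = U (enorm (y - c)).
Proof. by apply: uc; rewrite enorm_ray ger0_norm ?enorm_ge0. Qed.

Lemma is_derive_ray_height t : is_derive t 1 U (p t).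
Proof.
apply: (is_derive_ray (f := u)).
by apply: derivableP; have := u2.2 [::] 0 (ray t); exact.
Qed.

Lemma is_derive_ray_slope t : is_derive t 1 p (q t).
Proof.
apply: (is_derive_ray (f := partial 0 u)).
by apply: derivableP; have := u2.2 [:: 0] 0 (ray t); exact.
Qed.

Lemma ray_height_even t : U (- t) = U t.
Proof. by apply: uc; rewrite !enorm_ray normrN. Qed.

Lemma ray_slope0 : p 0 = 0.
Proof.
have := even_derive ray_height_even is_derive_ray_height 0.
by rewrite oppr0; lra.
Qed.

Lemma partial_radial i y : y != c ->
  partial i u y = p (enorm (y - c)) * ((y - c) 0 i / enorm (y - c)).
Proof.
move=> yc; have -> : u = (fun y => U (enorm (y - c))).
  by apply/funext => z; exact: radialE.
have [_] := @is_derive_chain _ _ U (fun y => enorm (y - c)) _ _ _ _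
  (is_derive_ray_height (enorm (y - c))) (is_derive_enorm i yc).
exact.
Qed.

Lemma sqr_enorm_grad_radial y : y != c ->
  enorm (grad u y) ^+ 2 = p (enorm (y - c)) ^+ 2.
Proof.
move=> yc; have N0 : enorm (y - c) != 0 by rewrite gt_eqF // enorm_gt0 subr_eq0.
rewrite sqr_enorm.
transitivity
    ((p (enorm (y - c)) / enorm (y - c)) ^+ 2 * \sum_i (y - c) 0 i ^+ 2).
  rewrite mulr_sumr; apply: eq_bigr => i _.
  by rewrite mxE partial_radial //; field.
by rewrite -sqr_enorm; field.
Qed.

Lemma ray_neq t : 0 < t -> ray t != c.
Proof.
by move=> t0; rewrite -subr_eq0 -enorm_gt0 enorm_ray normr_gt0 gt_eqF.
Qed.

Section Equation.
Hypotheses (eqn : soliton_equation u) (sp : spacelike u).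

Lemma sqr_ray_slope_lt1 t : 0 <= t -> p t ^+ 2 < 1.
Proof.
rewrite le_eqVlt => /predU1P[<-|t0]; first by rewrite ray_slope0 expr0n.
have := sqr_enorm_grad_radial (ray_neq t0).
rewrite enorm_ray gtr0_norm // => <-.
by rewrite expr_lt1 // ?enorm_ge0 // sp.
Qed.

(** The flux is the vector field [G (|y - c|) (y - c)] with
    [G t = p t / (t sqrt (1 - p^2))]. Its divergence at distance [t] from [c] is
    [n G + t G'], and multiplying the soliton equation by [sqrt (1 - p^2)] gives
    the equation for [p]. *)
Lemma soliton_ode t : 0 < t -> q t / (1 - p t ^+ 2) + m%:R / t * p t = 1.
Proof.
move=> t0; have tN0 : t != 0 by rewrite gt_eqF.
pose s t := Num.sqrt (1 + - (p t * p t)).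
pose G t := p t * (s t * t)^-1.
have p1 : 0 < 1 + - (p t * p t).
  by rewrite -expr2 subr_gt0 sqr_ray_slope_lt1 // ltW.
have s0 : 0 < s t by rewrite sqrtr_gt0.
have s2 : s t ^+ 2 = 1 - p t ^+ 2 by rewrite sqr_sqrtr ?expr2 // ltW.
have sN0 : s t != 0 by rewrite gt_eqF.
have dp := is_derive_ray_slope t.
pose s' := (0 + - (q t * p t + p t * q t)) / (2 * s t).
have ds : is_derive t 1 s s'.
  apply: (@is_derive_sqrtr _ _ (fun t => 1 + - (p t * p t))) => //.
  apply: (is_derive_add (is_derive_cstf 1 t)).
  exact/is_derive_opp/is_derive_mul.
pose G' := q t * (s t * t)^-1 +
  p t * (- (s t * t)^-1 ^+ 2 * (s' * t + s t * 1)).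
have dG : is_derive t 1 G G'.
  apply: (is_derive_mul dp); apply: (@is_derive_inv _ _ (fun t => s t * t)).
    by rewrite mulf_neq0.
  exact: (is_derive_mul ds (is_derive_idf t)).
set x := ray t; have xc : x != c by exact: ray_neq.
have xt : enorm (x - c) = t by rewrite enorm_ray gtr0_norm.
have areaE y : y != c -> area_element u y = s (enorm (y - c)).
  by move=> yc; rewrite /area_element sqr_enorm_grad_radial.
have partialE i :
    partial i (fun y => ((area_element u y)^-1 *: grad u y) 0 i) x =
    G' * ((x - c) 0 i / t) * (x - c) 0 i + G t.
  have FE : \near x, G (enorm (x - c)) * (x - c) 0 i =
      ((area_element u x)^-1 *: grad u x) 0 i.
    have : \near x, x != c.
      have cN : enorm (y - c) @[y --> x] --> t.
        by rewrite -xt; exact: cont_enorm.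
      near=> y; rewrite -subr_eq0 -enorm_gt0.
      by near: y; exact: cvgr_gt cN _ t0.
    move=> nxc; near=> y; have yc : y != c by near: y.
    rewrite !mxE areaE // partial_radial // /G invfM.
    by rewrite !mxE; ring.
  rewrite /partial -(near_eq_derive _ FE).
  have dN := is_derive_enorm i xc; rewrite xt in dN.
  have dGt : is_derive (enorm (x - c)) 1 G G' by rewrite xt.
  have [_ ->] := is_derive_mul (@is_derive_chain _ _ G (fun y => enorm (y - c))
    _ _ _ _ dGt dN) (is_derive_coord x c i i).
  by rewrite xt eqxx mulr1.
have mc : mean_curvature u x = n%:R * G t + t * G'.
  rewrite /mean_curvature /divergence (eq_bigr _ (fun i _ => partialE i)).
  rewrite big_split /= sumr_const card_ord addrC -[G t *+ _]mulr_natl.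
  congr (_ + _).
  transitivity (G' / t * \sum_i (x - c) 0 i ^+ 2).
    by rewrite mulr_sumr; apply: eq_bigr => i _; field.
  by rewrite -sqr_enorm xt; field.
have := eqn x; rewrite areaE // xt mc => /(congr1 (fun z => z * s t)).
rewrite mulVf // -s2 => H; rewrite -[RHS]H.
have -> : (n%:R * G t + t * G') * s t =
    m%:R * p t / t + q t + p t ^+ 2 * q t / s t ^+ 2.
  by rewrite /G /G' /s' -natr1; field; rewrite sN0.
have -> : p t ^+ 2 = 1 - s t ^+ 2 by rewrite s2; ring.
by field; rewrite sN0.
Unshelve. all: by end_near. Qed.

Lemma radial_solitonE x : u x = profile m (enorm (x - c)) + u c.
Proof.
have cp : {within `[0, +oo[, continuous p}.
  apply: continuous_subspaceT => t.
  by apply: is_derive_continuous (is_derive_ray_slope t).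
have cs : {within `[0, +oo[, continuous (@slope R m)}.
  exact/continuous_subspaceT/cinfty_cont/slope_smooth.
have pE t : 0 <= t -> p t = slope m t.
  apply: (@slope_unique R m p (slope m) _ _ cp cs
    (fun t _ => is_derive_ray_slope t) (fun t _ => slope_derive m t)
    sqr_ray_slope_lt1 (fun t _ => sqr_slope_lt1 m t) soliton_ode
    (@slope_ode R m)).
  by rewrite ray_slope0 slope0.
have dU t : 0 < t -> is_derive t 1 (fun t => U t + - u c) (slope m t).
  move=> t0; rewrite -pE ?ltW //.
  have := is_derive_add (is_derive_ray_height t) (is_derive_cstf (- u c) t).
  by rewrite addr0.
have cU : {within `[0, +oo[, continuous (fun t => U t + - u c)}.
  apply: continuous_subspaceT; apply: cont_add; last exact: cst_continuous.
  by move=> t; exact: is_derive_continuous (is_derive_ray_height t).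
have cP : {within `[0, +oo[, continuous (@profile R m)}.
  exact/continuous_subspaceT/cinfty_cont/profile_smooth.
have U0 : U 0 + - u c = profile m 0.
  by rewrite profile0 /U /ray scale0r add0r subrr.
have := halfline_primitive_unique cU cP dU (fun t _ => profile_derive m t) U0
  (enorm_ge0 (x - c)).
by move=> <-; rewrite -radialE subrK.
Qed.

End Equation.
End RadialSoliton.

(** * Geometry of the radial solitons *)

Section ProfileBounds.
Context {R : realType} {m : nat}.
Implicit Types (t : R).
Local Notation r := (@profile R m).
Local Notation p := (@slope R m).

Lemma slope_gt0 t : 0 < t -> 0 < p t.
Proof.
move=> t0; apply: lt_le_trans (slope_ge m (ltW t0)).
by rewrite divr_gt0 // sqrtr_gt0 ltr_wpDl ?sqr_ge0 // exprn_gt0.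
Qed.

Lemma profile_le t : 0 <= t -> r t <= t.
Proof.
move=> t0.
have d (x : R) : is_derive x 1 (fun t : R => t + - r t) (1 + - p x).
  exact: (is_derive_add (is_derive_idf x) (is_derive_opp (profile_derive m x))).
have cd : {within `[0, t], continuous (fun t : R => t + - r t)}.
  by apply: continuous_subspaceT => x; exact: is_derive_continuous (d x).
have := derive_ge0_nondecreasing t0 cd (fun x _ => d x).
rewrite profile0 subrr subr_ge0; apply => x _.
by rewrite subr_ge0 ltW // slope_lt1.
Qed.

(** The profile lies above its tangent line at 1, since its slope increases. *)
Lemma profile_ge t : 1 <= t -> p 1 * (t - 1) <= r t.
Proof.
move=> t1.
have slopeW (a b : R) : a <= b -> p a <= p b.
  move=> ab; apply: (@derive_ge0_nondecreasing R p (@slope' R m) a b ab).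
  - exact/continuous_subspaceT/cinfty_cont/slope_smooth.
  - by move=> x _; exact: slope_derive.
  - by move=> x _; exact/ltW/slope'_gt0.
have r1 : 0 <= r 1.
  rewrite -[leLHS](profile0 m).
  apply: (@derive_ge0_nondecreasing R r p 0 1 ler01).
  - exact/continuous_subspaceT/cinfty_cont/profile_smooth.
  - by move=> x _; exact: profile_derive.
  - by move=> x /andP[x0 _]; exact/ltW/slope_gt0.
have d (x : R) : is_derive x 1 (fun t : R => r t + - (p 1 * t))
    (p x + - (0 * x + p 1 * 1)).
  apply: (is_derive_add (profile_derive m x)); apply: is_derive_opp.
  exact: (is_derive_mul (is_derive_cstf (p 1) x) (is_derive_idf x)).
have cd : {within `[1, t], continuous (fun t : R => r t + - (p 1 * t))}.
  by apply: continuous_subspaceT => x; exact: is_derive_continuous (d x).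
have H := derive_ge0_nondecreasing t1 cd (fun x _ => d x).
have {}H : r 1 - p 1 * 1 <= r t - p 1 * t.
  apply: H => x /andP[x1 _].
  by rewrite mul0r add0r mulr1 subr_ge0 slopeW // ltW.
move: H; rewrite mulrBr mulr1; move: (r 1) (r t) (p 1) (p 1 * t) r1 => A B C D.
by clear; lra.
Qed.

End ProfileBounds.

Section Geometry.
Context {R : realType} {m : nat}.
Local Notation n := m.+1.
Variables (u : 'rV[R]_n -> R) (c : 'rV[R]_n) (k : R).
Hypothesis uE : forall x, u x = profile m (enorm (x - c)) + k.
Local Notation r := (@profile R m).
Local Notation p := (@slope R m).

Lemma radial_soliton_smooth : smooth u.
Proof.
apply: (@poly_radial_smooth _ _ c).
rewrite (_ : u = (fun x => r (enorm (x - c)) + k)); last exact/funext.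
apply: PolyRadial_add; last exact: poly_radial_cst.
apply: (@PolyRadial_radial _ _ c r); first exact: profile_smooth.
exact: profile_even.
Qed.

(** With [q = r' / t], the Hessian at distance [t] from [c] is
    [q I + (q' / t) y y^T] where [y = x - c]. It acts as [q] on the directions
    orthogonal to [y] and as [q + t q' = r''] along [y]; both are positive.
    The Cauchy-Schwarz inequality serves when [q' / t] is negative. *)
Lemma radial_soliton_strictly_convex : strictly_convex u.
Proof.
have [q [cq qN slopeE]] := odd_quotient (@slope_smooth R m) (@slope_odd R m).
have [Dq [_ _ dq]] := even_derive_quotient cq qN.
have dr (t : R) : is_derive t 1 r (t * q t).
  by rewrite -slopeE; exact: profile_derive.
have slope'E t : slope' m t = q t + t ^+ 2 * Dq t.
  have := is_derive_mul (is_derive_idf t) (dq t).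
  rewrite (_ : (fun y : R => y * q y) = p); last first.
    by apply/funext => s; rewrite slopeE.
  by move=> /(is_derive_unique (slope_derive m t)) ->; ring.
have q0 t : 0 <= t -> 0 < q t.
  rewrite le_eqVlt => /predU1P[<-|t0].
    by have := slope'_gt0 m (0 : R); rewrite slope'E expr0n mul0r addr0.
  by have := @slope_gt0 R m t t0; rewrite slopeE pmulr_rgt0.
have pu i x : partial i u x = (x - c) 0 i * q (enorm (x - c)).
  rewrite (_ : u = (fun x => r (enorm (x - c)) + k)); last exact/funext.
  have [_] := is_derive_add (is_derive_radial c x i (@profile_even R m) dr)
    (is_derive_cst k x (delta_mx 0 i)).
  by rewrite addr0.
move=> x v v0; set y := x - c; set t := enorm y.
have t0 : 0 <= t by exact: enorm_ge0.
have hE i j : hessian u x i j = (j == i)%:R * q t + y 0 j * (y 0 i * Dq t).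
  rewrite mxE (_ : partial j u = (fun x => (x - c) 0 j * q (enorm (x - c)))).
    have [_] := is_derive_mul (is_derive_coord x c i j)
      (is_derive_radial c x i qN dq).
    exact.
  by apply/funext => z; exact: pu.
have -> : (v *m hessian u x *m v^T) 0 0 =
    q t * enorm v ^+ 2 + Dq t * (\sum_i v 0 i * y 0 i) ^+ 2.
  rewrite sqr_enorm mxE.
  transitivity (\sum_j (q t * v 0 j ^+ 2 +
      Dq t * (\sum_i v 0 i * y 0 i) * (v 0 j * y 0 j))).
    apply: eq_bigr => j _; rewrite mxE [v^T _ _]mxE.
    have -> : \sum_i v 0 i * hessian u x i j =
        v 0 j * q t + (\sum_i v 0 i * y 0 i) * (y 0 j * Dq t).
      rewrite mulr_suml; transitivity (\sum_i (v 0 i * ((j == i)%:R * q t) +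
          v 0 i * y 0 i * (y 0 j * Dq t))).
        by apply: eq_bigr => i _; rewrite hE; ring.
      rewrite big_split /=; congr (_ + _).
      rewrite (bigD1 j) //= big1 => [|i ij]; first by rewrite eqxx mul1r addr0.
      by rewrite eq_sym (negPf ij) mul0r mulr0.
    by ring.
  by rewrite big_split /= -!mulr_sumr; ring.
have N0 : 0 < enorm v ^+ 2 by rewrite exprn_gt0 // enorm_gt0.
have CS := cauchy_schwarz_row v y; rewrite -/t in CS.
set b2 := (\sum_i _) ^+ 2 in CS *; have b0 : 0 <= b2 by exact: sqr_ge0.
have [D0|/ltW D0] := leP 0 (Dq t).
  by rewrite ltr_pwDl ?(mulr_ge0 D0 b0) // mulr_gt0 // q0.
have : 0 < enorm v ^+ 2 * slope' m t by rewrite mulr_gt0 // slope'_gt0.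
rewrite slope'E => /lt_le_trans; apply.
have := ler_wnM2l D0 CS; lra.
Qed.

(** The profile lies between [p 1 * (t - 1)] and [t]. Halving the slope absorbs
    the constant and the displacement of the center once [|x|] is large. *)
Lemma radial_soliton_linear_growth : linear_growth u.
Proof.
have a0 : 0 < p 1 by exact: slope_gt0.
have a1 : p 1 < 1 by exact: slope_lt1.
set a := p 1 in a0 a1.
pose N := enorm c; have N0 : 0 <= N by exact: enorm_ge0.
have K0 : 0 <= `|k| / a by rewrite divr_ge0 // ltW.
exists (a / 2), 2, (2 * (N + 1) + 2 * (`|k| / a)).
split; [by rewrite divr_gt0|by []|].
move=> x; set X := enorm x => Mx.
have up : enorm (x - c) <= X + N.
  by rewrite -[N]enormN; exact: ler_enormD.
have lo : X <= enorm (x - c) + N 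
  by have := ler_enormD (x - c) c; rewrite subrK.
have t0 := enorm_ge0 (x - c).
have rle := @profile_le R m _ t0.
have rge : a * (enorm (x - c) - 1) <= r (enorm (x - c)).
  by apply: profile_ge; lra.
have kE : `|k| = a * (`|k| / a) by field; rewrite gt_eqF.
have kK : `|k| <= `|k| / a by rewrite ler_pdivlMr // ler_piMr // ltW.
have k1 := ler_norm k; have k2 := ler_norm (- k); rewrite normrN in k2.
rewrite uE; apply/andP; split; last by lra.
have : a * (X - N - 1) <= a * (enorm (x - c) - 1) by rewrite ler_pM2l //; lra.
have : 0 <= a * (X / 2 - N - 1 - `|k| / a) by rewrite pmulr_rge0 //; lra.
rewrite !mulrBr -kE mulr1; lra.
Qed.

End Geometry.

Lemma radial_soliton_translate (R : realType) (m : nat)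
    (u1 u2 : 'rV[R]_m.+1 -> R) (a b : 'rV[R]_m.+1) (k l : R) :
  (forall x, u1 x = profile m (enorm (x - a)) + k) ->
  (forall x, u2 x = profile m (enorm (x - b)) + l) -> translate_of u1 u2.
Proof.
move=> u1E u2E; exists (row_mx (b - a) (l - k)%:M).
apply/seteqP; split=> z /=.
- move=> [x _ <-]; exists (row_mx (x - (b - a)) (u1 (x - (b - a)))%:M).
    by exists (x - (b - a)).
  rewrite add_row_mx subrK -raddfD /= u1E u2E; congr (row_mx _ _%:M).
  have -> : x - (b - a) - a = x - b by rewrite opprB [a - b]addrC addrA addrK.
  by ring.
- move=> [_ [x _ <-] <-]; exists (x + (b - a)) => //.
  rewrite add_row_mx -raddfD /= u1E u2E; congr (row_mx _ _%:M).
  have -> : x + (b - a) - b = x - a by rewrite [b - a]addrC addrA addrK.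
  by ring.
Qed.

Lemma translating_soliton_equation (R : realType) (n : nat)
    (u : 'rV[R]_n -> R) :
  translating_soliton u -> Ck 2 u /\ soliton_equation u.
Proof.
move=> [u2 _ eqn].
have u0 : (fun x => u x + 0) = u by apply/funext => x; rewrite addr0.
split; first by have := u2 0; rewrite u0.
move=> x; have := eqn x 0; rewrite u0.
have -> : derive1 (fun t : R => u x + t) 0 = 1.
  rewrite derive1E.
  have [_] := is_derive_add (is_derive_cstf (u x) 0) (is_derive_idf (0 : R)).
  by rewrite add0r.
move=> /esym H; have A0 : area_element u x != 0.
  by apply/eqP => A0; move: H; rewrite A0 mul0r => /esym/eqP; rewrite oner_eq0.
by rewrite -[RHS]mulr1 -H mulKf.
Qed.

Theorem theorem1p1 (R : realType) (n : nat) (hn : (1 <= n)%N) :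
  (exists r : R -> R,
    [/\ radial_ivp_solution n r,
        forall s : R -> R, radial_ivp_solution n s ->
          forall t : R, 0 <= t -> s t = r t,
        forall (u : 'rV[R]_n -> R) (x0 : 'rV[R]_n),
          Ck 2 u -> is_vertex u x0 -> soliton_equation u -> spacelike u ->
          forall x, u x = r (enorm (x - x0)) + u x0,
        Cinfty_nng r &
        forall t : R, 0 <= t ->
          [/\ t / Num.sqrt (n%:R ^+ 2 + t ^+ 2) <= derive_nng r t,
              derive_nng r t < 1 &
              0 < deriven_nng 2 r t <= 1]]) /\
  (forall u : 'rV[R]_n -> R,
    radially_symmetric u -> spacelike u -> translating_soliton u ->
    [/\ smooth u, strictly_convex u & linear_growth u]) /\
  (forall u1 u2 : 'rV[R]_n -> R,
    radially_symmetric u1 -> spacelike u1 -> translating_soliton u1 ->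
    radially_symmetric u2 -> spacelike u2 -> translating_soliton u2 ->
    translate_of u1 u2).
Proof.
case: n hn => [//|m] _.
have solE (u : 'rV[R]_m.+1 -> R) : radially_symmetric u -> spacelike u ->
    translating_soliton u ->
    exists2 c, True & forall x, u x = profile m (enorm (x - c)) + u c.
  move=> [c uc] sp /translating_soliton_equation[u2 eqn].
  by exists c => // x; exact: radial_solitonE.
split; [|split].
- exists (profile m); split.
  + exact: profile_radial_ivp.
  + by move=> s /radial_ivp_unique.
  + by move=> u x0 u2 uc eqn sp x; exact: radial_solitonE.
  + exact/smooth_Cinfty_nng/profile_smooth.
  + move=> t t0; have [-> ->] := profile_derive_nng m t0.
    by rewrite slope_ge // slope_lt1 slope'_gt0 slope'_le1.
- move=> u ru sp tu; have [c _ uE] := solE u ru sp tu; split.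
  + exact: radial_soliton_smooth uE.
  + exact: radial_soliton_strictly_convex uE.
  + exact: radial_soliton_linear_growth uE.
- move=> u1 u2 r1 s1 t1 r2 s2 t2.
  have [a _ u1E] := solE u1 r1 s1 t1; have [b _ u2E] := solE u2 r2 s2 t2.
  exact: radial_soliton_translate u1E u2E.
Qed.
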